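(* In the abelian case associated with $\alpha_i\in\Pi$, the posets $(\mathrm{AN}(\Delta(1)),\le_{up})$ and $(\mathcal P(\varphi_i^\vee),\preccurlyeq)$ are naturally isomorphic; explicitly, the map $\Gamma_w\mapsto w(\varphi_i^\vee)$, $w\in W^0$, where $\Gamma_w=\min(\Delta(1)\setminus N(w))$, is an isomorphism.
   Context: Let $\mathfrak g$ be a complex simple Lie algebra with root system $\Delta$ in a real Euclidean space with $W$-invariant inner product $(\,,\,)$, positive roots $\Delta^+$, simple roots $\Pi=\{\alpha_1,\dots,\alpha_n\}$, Weyl group $W$, highest root $\theta$. For $\gamma\in\Delta$, $\gamma^\vee=2\gamma/(\gamma,\gamma)$; $\Delta^\vee=\{\gamma^\vee\}$ is the dual root system with simple roots $\Pi^\vee=\{\alpha^\vee:\alpha\in\Pi\}$. Abelian case: fix $\alpha_i\in\Pi$ whose coefficient in $\theta$ equals $1$; $\Delta(j)$ is the set of roots whose $\alpha_i$-coefficient is $j$, $\Delta(0)^+=\Delta(0)\cap\Delta^+$, and $\Delta(1)$ is partially ordered by $\mu\preccurlyeq\gamma$ iff $\gamma-\mu$ is a nonnegative integer combination of $\Pi\setminus\{\alpha_i\}$. $W^0=\{w\in W:w(\alpha)\in\Delta^+\ \forall\alpha\in\Delta(0)^+\}$, $N(w)=\{\gamma\in\Delta^+:w(\gamma)\in-\Delta^+\}$. $\varphi_i^\vee$ is the fundamental weight of $\Delta^\vee$ defined by $(\varphi_i^\vee,\alpha_j)=\delta_{ij}$ for all $j$ (it is minuscule). $\mathcal P(\varphi_i^\vee)$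 is the set of weights of the irreducible representation with highest weight $\varphi_i^\vee$ of the Lie algebra $\mathfrak g^\vee$ with root system $\Delta^\vee$ (equal to the orbit $W\varphi_i^\vee$), ordered by $\nu\preccurlyeq\mu$ iff $\mu-\nu$ is a nonnegative integer combination of $\Pi^\vee$. $\mathrm{AN}(\Delta(1))$ is the set of antichains of $\Delta(1)$, ordered by $\Gamma\le_{up}\Gamma'$ iff $I(\Gamma)\subset I(\Gamma')$, where $I(\Gamma)$ is the upper ideal generated by $\Gamma$. *)

(* Defs.v *)
From mathcomp Require Import all_boot all_order all_algebra.
From mathcomp Require Import boolp classical_sets functions reals.
From mathcomp Require Export complex.

Set Implicit Arguments.
Unset Strict Implicit.
Unset Printing Implicit Defensive.

Import Order.TTheory GRing.Theory Num.Theory.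

Local Open Scope classical_set_scope.
Local Open Scope ring_scope.
Local Open Scope complex_scope.

Section RootSystems.
Variables (R : realType) (E : vectType R) (ip : {dot E for idfun}).

Definition coroot (a : E) : E := (2 / ip a a) *: a.

Definition reflection (a v : E) : E := v - ip v (coroot a) *: a.

Record is_root_system (Phi : seq E) : Prop := IsRootSystem {
  rs_span : <<Phi>>%VS = fullv;
  rs_neq0 : 0 \notin Phi;
  rs_refl : forall a b, a \in Phi -> b \in Phi -> reflection a b \in Phi;
  rs_int : forall a b, a \in Phi -> b \in Phi ->
    exists m : int, ip b (coroot a) = m%:~R;
  rs_reduced : forall (a : E) (c : R),
    a \in Phi -> c *: a \in Phi -> c = 1 \/ c = -1 }.

Definition is_irreducible_rs (Phi : seq E) : Prop :=
  Phi <> [::] /\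
  forall P : pred E,
    (exists2 a, a \in Phi & P a) -> (exists2 b, b \in Phi & ~~ P b) ->
    exists a b, [/\ a \in Phi, b \in Phi, P a, ~~ P b & ip a b != 0].

(* Nonnegative integer combinations of the alpha_j with J j. *)
Definition nncomb n (alpha : n.-tuple E) (J : pred 'I_n) (v : E) : Prop :=
  exists c : 'I_n -> nat, v = \sum_(j | J j) tnth alpha j *+ c j.

Definition is_simple_system (Phi : seq E) n (alpha : n.-tuple E) : Prop :=
  [/\ basis_of fullv alpha, {subset alpha <= Phi} &
      forall g, g \in Phi ->
        nncomb alpha predT g \/ nncomb alpha predT (- g)].

(* The generating reflections are involutions, so the monoid they generate is
   the Weyl group. *)
Inductive weyl (Phi : seq E) : (E -> E) -> Prop :=
  | weyl_id : weyl Phi idfun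
  | weyl_refl a w : a \in Phi -> weyl Phi w ->
      weyl Phi (reflection a \o w).

Definition dual_roots (Phi : seq E) : seq E := map coroot Phi.

Definition dual_simple n (alpha : n.-tuple E) : n.-tuple E :=
  map_tuple coroot alpha.

Section Simple.
Variables (Phi : seq E) (n : nat) (alpha : n.-tuple E).

Definition pos_roots : set E :=
  [set g | g \in Phi /\ nncomb alpha predT g].

Definition is_highest_root (theta : E) : Prop :=
  theta \in Phi /\
  forall g, g \in Phi -> nncomb alpha predT (theta - g).

Definition root_le (nu mu : E) : Prop := nncomb alpha predT (mu - nu).

Definition inversions (w : E -> E) : set E :=
  [set g | pos_roots g /\ pos_roots (- w g)].

Variable i : 'I_n.

(* coord alpha i g is the coefficient of alpha_i in g, alpha being a basis. *)
Definition Delta (k : int) : set E :=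
  [set g | g \in Phi /\ coord alpha i g = k%:~R].

Definition W0 : set (E -> E) :=
  [set w | weyl Phi w /\
     forall g, Delta 0 g -> pos_roots g -> pos_roots (w g)].

Definition le1 (mu g : E) : Prop := nncomb alpha (predC1 i) (g - mu).

Definition min1 (S : set E) : set E :=
  [set g | S g /\ forall mu, S mu -> le1 mu g -> mu = g].

Definition antichains : set (set E) :=
  [set G | G `<=` Delta 1 /\
     forall mu g, G mu -> G g -> le1 mu g -> mu = g].

Definition upper_ideal (G : set E) : set E :=
  [set g | Delta 1 g /\ exists2 mu, G mu & le1 mu g].

Definition le_up (G G' : set E) : Prop := upper_ideal G `<=` upper_ideal G'.

Definition Gamma (w : E -> E) : set E := min1 (Delta 1 `\` inversions w).

End Simple.
End RootSystems.

Section LieAlgebras.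
Variable (R : realType).
Local Notation C := R[i].
Variable (L : vectType C).

Record is_lie_bracket (br : {bilinear L -> L -> L}) : Prop := IsLieBracket {
  lie_alt : forall x, br x x = 0;
  lie_jacobi : forall x y z,
    br x (br y z) + br y (br z x) + br z (br x y) = 0 }.

Definition is_simple_lie (br : {bilinear L -> L -> L}) : Prop :=
  (exists x y, br x y != 0) /\
  forall I : {vspace L}, (forall x y, y \in I -> br x y \in I) ->
    I = 0%VS \/ I = fullv.

Section Roots.
Variables (E : vectType R) (ip : {dot E for idfun}).

(* The element rho x plays the role of x under the identification of E with
   its dual; in particular, when Phi is the dual root system of some Psi, the
   coroot of g^v (g in Psi) is rho g.
   Linear forms on a Cartan subalgebra H that are real combinations of roots
   are encoded as vectors of E, through an R-linear map rho : E -> L whose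
   image is a real form of H: the form encoded by nu sends rho x to (nu, x).
   The same definition gives root spaces (the adjoint action) and weight
   spaces (an arbitrary action). *)
Definition weight_space (V : vectType C) (act : {bilinear L -> V -> V})
    (rho : E -> L) (nu : E) : set V :=
  [set v | forall x, act (rho x) v = (ip nu x)%:C *: v].

(* By cartan_add and cartan_scale rho is R-linear;
   H = rho E + i rho E is a Cartan subalgebra of L, with set of roots Phi:
   L is the sum of H, which is the zero weight space of the adjoint action,
   and of nonzero root spaces, one for each element of Phi. *)
Record has_root_system (br : {bilinear L -> L -> L}) (rho : E -> L)
    (Phi : seq E) : Prop := HasRootSystem {
  cartan_add : forall x y, rho (x + y) = rho x + rho y;
  cartan_scale : forall (a : R) x, rho (a *: x) = a%:C *: rho x;
  cartan_zero : forall y, weight_space br rho 0 y <->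
    exists x x', y = rho x + 'i *: rho x';
  cartan_root : forall b, b \in Phi ->
    exists2 y, y != 0 & weight_space br rho b y;
  cartan_decomp : forall y, exists y0, exists z : E -> L,
    [/\ weight_space br rho 0 y0,
        forall b, weight_space br rho b (z b) &
        y = y0 + \sum_(b <- undup Phi) z b] }.

Variables (V : vectType C) (br : {bilinear L -> L -> L}).
Variables (act : {bilinear L -> V -> V}).

Definition is_representation : Prop :=
  forall x y v, act (br x y) v = act x (act y v) - act y (act x v).

Definition is_irreducible_rep : Prop :=
  (exists v : V, v != 0) /\
  forall U : {vspace V}, (forall x u, u \in U -> act x u \in U) ->
    U = 0%VS \/ U = fullv.

Definition is_highest_weight (rho : E -> L) (Phi : seq E) n
    (alpha : n.-tuple E) (lambda : E) : Prop :=
  exists v : V, [/\ v != 0, weight_space act rho lambda v &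
    forall b, pos_roots Phi alpha b ->
    forall y, weight_space br rho b y -> act y v = 0].

Definition weights (rho : E -> L) : set E :=
  [set nu | exists2 v, v != 0 & weight_space act rho nu v].

End Roots.
End LieAlgebras.

(* Main.v *)
(* For w in W^0 the set N(w) lies in Delta(1) and is a lower ideal. If w phi
   pairs to 1 with a simple root alpha, then s_alpha w is again in W^0,
   N(s_alpha w) is N(w) with one more root, and w phi drops by alpha^vee. Since
   phi is minuscule, every comparison in the orbit W phi and every inclusion of
   lower ideals is realised by such steps; as N(w) and w phi each determine w in
   W^0, this gives the isomorphism between antichains and the orbit W phi.

   The weights of V are that orbit. Simplicity of L makes the trace form of V
   nondegenerate, which yields an sl_2-triple (e, f, h) for every root; comparing
   the two reflections on the finite set of roots shows that h is the coroot, so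
   the weights are stable under W. All weights lie below phi, and a dominant
   weight below the minuscule phi belongs to W phi. *)

From HB Require Import structures.
Require Import Defs.
From mathcomp Require Import all_boot all_order all_algebra.
From mathcomp Require Import boolp classical_sets functions reals.
From mathcomp Require Import ring lra zify.

Set Implicit Arguments.
Unset Strict Implicit.
Unset Printing Implicit Defensive.

Import Order.TTheory GRing.Theory Num.Theory.

Local Open Scope classical_set_scope.
Local Open Scope ring_scope.

(** [has_root_system] says nothing on the dimension of root spaces, on coroots inside L or on
    integrality, so these facts must be produced. Nondegeneracy of the trace form comes from
    reality: at [rho x] it is a sum of squares of real numbers, and a nonzero weight gives a nonzero
    term. For opposite root vectors e and f the bracket is then known only as rho y + i rho y'.
    Strings for such a triple already give integrality and a reflection; in the adjoint
    representation, whose weights are among finitely many known vectors, this reflection can be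
    identified, which gives y = g and y' = 0 for the root g^vee. So h = [rho g]: a weight pairs with
    roots of [Phi] and moves along coroots, exactly as the orbit of [phi] does. On the combinatorial
    side Weyl group elements are words in simple reflections, inverted by reversal. The pairing of w
    phi with a simple root is the [al i]-coefficient, or degree, of the preimage of that root under
    w, which ties the orbit to inversions. *)

(** A subspace of maximal dimension inside [P] contains every vector of [P], since otherwise a line
    could be added. This lets irreducibility and simplicity, stated for [{vspace _}], be applied to
    predicates. *)
Lemma submod_vspace (K : fieldType) (V : vectType K) (P : V -> Prop) :
  P 0 -> (forall a u v, P u -> P v -> P (a *: u + v)) ->
  exists U : {vspace V}, forall v, v \in U <-> P v.
Proof.
move=> P0 PD; pose Q k := `[< exists2 U : {vspace V}, \dim U = k &
  forall v, v \in U -> P v >].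
have Q0 : exists k, Q k.
  exists 0%N; apply/asboolP; exists 0%VS; first exact: dimv0.
  by move=> v; rewrite memv0 => /eqP->.
have Qb k : Q k -> (k <= \dim {:V})%N.
  by move=> /asboolP[U <- _]; rewrite dimvS ?subvf.
case: (ex_maxnP Q0 Qb) => k /asboolP[U Uk UP] kmax; exists U => v.
split=> [|Pv]; first exact: UP.
apply: contraT => vU; have : Q (\dim (U + <[v]>)%VS).
  apply/asboolP; exists (U + <[v]>)%VS => // _ /memv_addP[u uU [_ /vlineP[a ->] ->]].
  by rewrite addrC; apply: PD => //; exact: UP.
move=> /kmax; rewrite -Uk leqNgt => /negP; case.
rewrite ltn_neqAle dimvS ?addvSl// andbT; apply: contra vU => /eqP e.
have := (dimv_leqif_sup (addvSl U <[v]>%VS)).2; rewrite -e eqxx => /esym.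
by rewrite subv_add subvv/= -memvE.
Qed.

Lemma finite_escape (T : eqType) (s : seq T) (f : nat -> T) :
  injective f -> exists k, f k \notin s.
Proof.
move=> fI; apply: contrapT => h.
have := @uniq_leq_size _ (map f (iota 0 (size s).+1)) s.
rewrite map_inj_uniq// iota_uniq size_map size_iota ltnn => h'.
suff: false by []; apply: h' => //.
move=> _ /mapP[k _ ->]; apply: contraT => ks; case: h; by exists k.
Qed.

Lemma ex_least (P : nat -> Prop) : (exists k, P k) ->
  exists k, P k /\ forall j, (j < k)%N -> ~ P j.
Proof.
move=> [k Pk]; have ex : exists k, `[< P k >] by exists k; exact/asboolP.
case: (ex_minnP ex) => m /asboolP Pm hm; exists m; split=> // j jm /asboolP/hm.
by rewrite leqNgt jm.
Qed.

(** Invariance of the trace form; the commutators are reversed because [amx] below reverses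
    products. *)
Lemma mxtrace_commutator (K : comNzRingType) d (A B C : 'M[K]_d) :
  \tr ((B *m A - A *m B) *m C) = \tr (A *m (C *m B - B *m C)).
Proof.
rewrite mulmxBl mulmxBr !raddfB/= !mulmxA; congr (_ - _).
by rewrite -[B *m _ *m _]mulmxA [LHS]mxtrace_mulC.
Qed.

Lemma ex_argmin (T : eqType) (R : realDomainType) (F : T -> R)
    (P : T -> Prop) (s : seq T) (x : T) : x \in s -> P x ->
  exists y, [/\ y \in s, P y & forall z, z \in s -> P z -> F y <= F z].
Proof.
elim: s x => // a s IH x xs Px.
have [[y ys Py]|hn] := pselect (exists2 y, y \in s & P y); last first.
  exists x; split=> // z; rewrite inE => /orP[/eqP->|zs] Pz; last by case: hn; exists z.
  by move: xs; rewrite inE => /orP[/eqP->//|xs]; case: hn; exists x.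
have [b [bs Pb hb]] := IH y ys Py.
have [[Pa ab]|h] := pselect (P a /\ F a <= F b).
  exists a; split; rewrite ?mem_head// => z; rewrite inE => /orP[/eqP->//|zs] Pz.
  exact: le_trans ab (hb z zs Pz).
exists b; split; rewrite ?inE ?bs ?orbT// => z; rewrite inE => /orP[/eqP->|]; last exact: hb.
by move=> Pa; rewrite leNgt; apply/negP => /ltW ?; apply: h.
Qed.

Lemma ltn_count (T : eqType) (p q : pred T) (s : seq T) (x : T) :
  subpred p q -> x \in s -> q x -> ~~ p x -> (count p s < count q s)%N.
Proof.
move=> pq xs qx px; elim: s xs => //= a s IH; rewrite inE => /orP[/eqP<-|xs].
  by rewrite qx (negPf px) add0n add1n ltnS sub_count.
by rewrite -addnS leq_add ?IH//; case: (boolP (p a)) => // /pq->.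
Qed.

(** * Reflections and simple systems *)

Section InnerProduct.
Variables (R : realType) (E : vectType R) (ip : {dot E for idfun}).
Implicit Types (a b u v w : E).

Lemma ipC u v : ip u v = ip v u.
Proof. by rewrite hermC expr0 mul1r. Qed.
Lemma ipDl u v w : ip (u + v) w = ip u w + ip v w.
Proof. exact: linearDl. Qed.
Lemma ipZl c u v : ip (c *: u) v = c * ip u v.
Proof. exact: linearZl_LR. Qed.
Lemma ipDr u v w : ip u (v + w) = ip u v + ip u w.
Proof. by rewrite ipC ipDl !(ipC _ u). Qed.
Lemma ipZr c u v : ip u (c *: v) = c * ip u v.
Proof. by rewrite ipC ipZl ipC. Qed.
Lemma ipNl u v : ip (- u) v = - ip u v.
Proof. by rewrite -scaleN1r ipZl mulN1r. Qed.
Lemma ipNr u v : ip u (- v) = - ip u v.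
Proof. by rewrite ipC ipNl ipC. Qed.
Lemma ip0l u : ip 0 u = 0.
Proof. by rewrite -(scale0r 0) ipZl mul0r. Qed.
Lemma ip0r u : ip u 0 = 0.
Proof. by rewrite ipC ip0l. Qed.
Definition ipE := (ipDl, ipDr, ipNl, ipNr, ipZl, ipZr, ip0l, ip0r).

Lemma ip_sumr (I : Type) (r : seq I) (P : pred I) (F : I -> E) u :
  ip u (\sum_(j <- r | P j) F j) = \sum_(j <- r | P j) ip u (F j).
Proof. by apply: (big_morph (ip u)) => [x y|]; rewrite ipE. Qed.

Lemma ip_gt0 u : u != 0 -> 0 < ip u u.
Proof. exact: neq0_dnorm_gt0. Qed.
Lemma ip_eq0 u : (ip u u == 0) = (u == 0).
Proof.
have [->|u0] := eqVneq u 0; first by rewrite ip0l eqxx.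
by rewrite gt_eqF// ip_gt0.
Qed.
Lemma ip_nondeg u : (forall v, ip u v = 0) -> u = 0.
Proof. by move=> /(_ u) /eqP; rewrite ip_eq0 => /eqP. Qed.

Lemma reflection_is_linear a : linear (reflection ip a).
Proof.
move=> c u v; rewrite /reflection !ipE scalerBr scalerDl scalerA opprD.
by rewrite addrACA.
Qed.
HB.instance Definition _ a := GRing.isLinear.Build R E E _ (reflection ip a)
  (reflection_is_linear a).

Lemma reflectionE a v : reflection ip a v = v - ip v a *: coroot ip a.
Proof. by rewrite /reflection /coroot ipE !scalerA mulrC. Qed.

Lemma ip_coroot a v : ip v (coroot ip a) = 2 * ip v a / ip a a.
Proof. by rewrite /coroot ipE mulrAC. Qed.

Lemma ip_self_coroot a : a != 0 -> ip a (coroot ip a) = 2.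
Proof. by move=> /ip_gt0 a0; rewrite ip_coroot mulfK ?gt_eqF. Qed.

Lemma coroot_neq0 a : a != 0 -> coroot ip a != 0.
Proof.
move=> /[dup]/ip_gt0 h a0; rewrite /coroot scaler_eq0 negb_or a0.
by rewrite mulf_neq0 ?invr_eq0 ?gt_eqF.
Qed.

Lemma ip_coroot_gt0 a v : a != 0 -> (0 < ip v (coroot ip a)) = (0 < ip v a).
Proof.
by move=> /ip_gt0 h; rewrite ip_coroot pmulr_lgt0 ?invr_gt0// pmulr_rgt0.
Qed.

Lemma corootN a : coroot ip (- a) = - coroot ip a.
Proof. by rewrite /coroot !ipE opprK scalerN. Qed.

Lemma reflection_self a : a != 0 -> reflection ip a a = - a.
Proof.
by move=> a0; rewrite /reflection ip_self_coroot// -{1}(scale1r a) -scalerBl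
  -scaleN1r; congr (_ *: _); ring.
Qed.

Lemma reflectionK a : involutive (reflection ip a).
Proof.
move=> v; have [->|a0] := eqVneq a 0.
  by rewrite /reflection !scaler0 !subr0.
rewrite {2}/reflection linearB linearZ/= reflection_self// /reflection.
by rewrite scalerN opprK subrK.
Qed.

Lemma reflection_ip a u v :
  ip (reflection ip a u) (reflection ip a v) = ip u v.
Proof.
have [->|/ip_gt0/lt0r_neq0 a0] := eqVneq a 0.
  by rewrite /reflection !scaler0 !subr0.
rewrite /reflection /coroot !ipE (ipC a v).
by field.
Qed.

Section Isometry.
Variable f : {linear E -> E}.
Hypothesis f_ip : forall u v, ip (f u) (f v) = ip u v.

Lemma coroot_isom a : coroot ip (f a) = f (coroot ip a).
Proof. by rewrite /coroot f_ip linearZ/=. Qed.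

Lemma reflection_isom a v : reflection ip (f a) (f v) = f (reflection ip a v).
Proof. by rewrite /reflection coroot_isom f_ip [in RHS]linearB/= [in RHS]linearZ. Qed.
End Isometry.

End InnerProduct.

Section NonnegativeCombinations.
Variables (R : realType) (E : vectType R) (n : nat) (alpha : n.-tuple E).
Variable J : pred 'I_n.

Lemma nncomb0 : nncomb alpha J 0.
Proof. by exists (fun=> 0%N); rewrite big1// => j _; rewrite mulr0n. Qed.

Lemma nncombD u v : nncomb alpha J u -> nncomb alpha J v ->
  nncomb alpha J (u + v).
Proof.
move=> [c ->] [d ->]; exists (fun j => c j + d j)%N.
by rewrite -big_split/=; apply: eq_bigr => j _; rewrite mulrnDr.
Qed.

Lemma nncombMn j m : J j -> nncomb alpha J (tnth alpha j *+ m).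
Proof.
move=> Jj; exists (fun k => if k == j then m else 0)%N.
rewrite (bigD1 j)//= eqxx big1 ?addr0// => k /andP[_ /negPf->].
by rewrite mulr0n.
Qed.
End NonnegativeCombinations.

Section SimpleSystem.
Variables (R : realType) (E : vectType R) (ip : {dot E for idfun}).
Variables (Phi : seq E) (n : nat) (alpha : n.-tuple E).
Hypothesis (Phi_rs : is_root_system ip Phi).
Hypothesis (alpha_simple : is_simple_system Phi alpha).

Local Notation al j := (tnth alpha j).
Local Notation co j := (coord alpha j).
Local Notation pos := (nncomb alpha predT).
Local Notation rf := (reflection ip).

Lemma simple_basis : basis_of fullv alpha. Proof. by case: alpha_simple. Qed.

Lemma co_al j k : co j (al k) = (j == k)%:R.
Proof.
by rewrite (tnth_nth 0) coord_free ?(basis_free simple_basis)// eq_sym.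
Qed.

Lemma coE v : v = \sum_j co j v *: al j.
Proof.
rewrite {1}(coord_basis simple_basis (memvf v)).
by apply: eq_bigr => j _; rewrite (tnth_nth 0).
Qed.

Lemma co_eq0 v : (forall j, co j v = 0) -> v = 0.
Proof. by move=> h; rewrite (coE v) big1// => j _; rewrite h scale0r. Qed.

Lemma co_nncomb (J : pred 'I_n) (c : 'I_n -> nat) k :
  co k (\sum_(j | J j) al j *+ c j) = if J k then (c k)%:R else 0.
Proof.
rewrite linear_sum/=.
transitivity (\sum_(j | J j) (k == j)%:R *+ c j : R).
  by apply: eq_bigr => j _; rewrite linearMn/= co_al.
case: ifP => Jk.
  rewrite (bigD1 k)//= eqxx big1 ?addr0// => j /andP[_].
  by rewrite eq_sym => /negPf->; rewrite mul0rn.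
by apply: big1 => j Jj; case: eqP => [kj|_]; rewrite ?mul0rn//; rewrite kj Jj in Jk.
Qed.

Lemma nncombP (J : pred 'I_n) v : nncomb alpha J v <->
  forall j, (exists m : nat, co j v = m%:R) /\ (~~ J j -> co j v = 0).
Proof.
split=> [[c ->] j|h].
  rewrite co_nncomb; split; last by move=> /negPf->.
  by case: ifP => _; [exists (c j)|exists 0%N].
have [c hc] := choice (fun j => (h j).1).
exists c; rewrite {1}(coE v) [RHS]big_mkcond/=; apply: eq_bigr => j _.
case: ifP => Jj; first by rewrite hc scaler_nat.
by have [_ ->] := h j; rewrite ?scale0r ?Jj.
Qed.

Lemma posP v : pos v <-> forall j, exists m : nat, co j v = m%:R.
Proof.
rewrite nncombP; split=> h j; first by case: (h j).
by split.
Qed.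

Lemma nncomb_pos J v : nncomb alpha J v -> pos v.
Proof. by move=> /nncombP h; apply/posP => j; case: (h j). Qed.

Lemma pos_ge0 v j : pos v -> 0 <= co j v.
Proof. by move=> /posP/(_ j)[m ->]. Qed.

Lemma pos_anti v : pos v -> pos (- v) -> v = 0.
Proof.
move=> h h'; apply: co_eq0 => j; apply/eqP; rewrite eq_le pos_ge0// andbT.
by rewrite -oppr_ge0 -linearN; exact: pos_ge0.
Qed.

Lemma root_neq0 g : g \in Phi -> g != 0.
Proof. by move=> gP; apply: contraNneq (rs_neq0 Phi_rs) => <-. Qed.

Lemma opp_root g : g \in Phi -> - g \in Phi.
Proof.
by move=> gP; rewrite -(@reflection_self _ _ ip) ?root_neq0// (rs_refl Phi_rs).
Qed.

Lemma root_rf a g : a \in Phi -> g \in Phi -> rf a g \in Phi.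
Proof. exact: (rs_refl Phi_rs). Qed.

Lemma simple_root j : al j \in Phi.
Proof. by case: alpha_simple => _ h _; apply: h; exact: mem_tnth. Qed.

Lemma simple_neq0 j : al j != 0.
Proof. exact: root_neq0 (simple_root j). Qed.

Lemma pos_simple j : pos (al j).
Proof. by apply/posP => k; rewrite co_al; exists (k == j). Qed.

Lemma root_sign g : g \in Phi -> pos g \/ pos (- g).
Proof. by case: alpha_simple => _ _; apply. Qed.

Lemma root_not_pos g : g \in Phi -> ~ pos g -> pos (- g).
Proof. by move=> /root_sign[]. Qed.

Lemma root_pos_neg g : g \in Phi -> pos g -> ~ pos (- g).
Proof. by move=> /root_neq0/eqP g0 h /(pos_anti h). Qed.

Lemma co_int g j : g \in Phi -> exists m : int, co j g = m%:~R.
Proof.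
move=> /root_sign[|] /posP/(_ j)[m]; first by exists m.
by rewrite linearN/= => h; exists (- m%:Z); rewrite mulrNz -pmulrn -h opprK.
Qed.

Lemma root_co_pos g j : g \in Phi -> 0 < co j g -> pos g.
Proof.
move=> /root_sign[//|/pos_ge0-/(_ j)]; rewrite linearN/= oppr_ge0 => h h'.
by have := lt_le_trans h' h; rewrite ltxx.
Qed.

Lemma co_rf k j v : k != j -> co k (rf (al j) v) = co k v.
Proof.
by move=> kj; rewrite /reflection linearB linearZ/= co_al (negPf kj) mulr0 subr0.
Qed.

(** If only the coefficient at [j] survived, [g] would be a multiple of [al j], and reducedness
    would leave only [al j] itself. *)
Lemma root_other_co j g : g \in Phi -> pos g -> g <> al j ->
  exists2 k, k != j & 0 < co k g.
Proof.
move=> gP gp gj; apply: contrapT => h; case: gj.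
have gE : g = co j g *: al j.
  rewrite {1}(coE g) (bigD1 j)//= big1 ?addr0// => k kj.
  have /posP/(_ k)[m hm] := gp.
  case: m hm => [->|m hm]; first by rewrite scale0r.
  by case: h; exists k => //; rewrite hm ltr0n.
move: gP; rewrite gE => gP.
case: (rs_reduced Phi_rs (simple_root j) gP) => c; first by rewrite c scale1r.
by have := pos_ge0 j gp; rewrite c oppr_ge0 ler10.
Qed.

(** The reflection changes only the coefficient at [j]; another positive coefficient survives and
    decides the sign. *)
Lemma rf_simple_pos j g : g \in Phi -> pos g -> g <> al j -> pos (rf (al j) g).
Proof.
move=> gP gp gj; have [k kj kg] := root_other_co gP gp gj.
apply: (@root_co_pos _ k); last by rewrite co_rf.
by rewrite root_rf ?simple_root.
Qed.

(** (v, v) > 0 is a combination of the (v, al j) with nonnegative coefficients, so one of its terms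
    is positive. *)
Lemma ex_simple_gt0 v : v != 0 -> (forall j, 0 <= co j v) ->
  exists j, 0 < co j v /\ 0 < ip v (al j).
Proof.
move=> v0 h; apply: contrapT => hn.
have := ip_gt0 ip v0; rewrite {2}(coE v) ip_sumr.
apply/negP; rewrite -leNgt; apply: sumr_le0 => j _; rewrite ipZr.
have [cj|cj] := ltP 0 (co j v).
  rewrite pmulr_rle0// leNgt; apply/negP => h'; apply: hn; by exists j.
by have -> : co j v = 0; [apply/eqP; rewrite eq_le cj h | rewrite mul0r].
Qed.

Definition ht v := \sum_j co j v.
Lemma ht_is_linear : linear_for *%R ht.
Proof.
move=> c u v; rewrite /ht mulr_sumr -big_split/=.
by apply: eq_bigr => j _; rewrite linearP.
Qed.
Lemma htD u v : ht (u + v) = ht u + ht v.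
Proof. by rewrite -{1}(scale1r u) ht_is_linear mul1r. Qed.
Lemma htZ c v : ht (c *: v) = c * ht v.
Proof.
rewrite -{1}(addr0 (c *: v)) ht_is_linear [ht 0]big1 ?addr0// => j _.
by rewrite linear0.
Qed.
Lemma htN v : ht (- v) = - ht v.
Proof. by rewrite -scaleN1r htZ mulN1r. Qed.
Lemma ht_al j : ht (al j) = 1.
Proof.
rewrite /ht (bigD1 j)//= co_al eqxx big1 ?addr0// => k kj.
by rewrite co_al (negPf kj).
Qed.
Lemma ht_nat v : pos v -> exists m : nat, ht v = m%:R.
Proof.
move=> /posP/choice[c hc].
by exists (\sum_j c j)%N; rewrite natr_sum; apply: eq_bigr.
Qed.
Lemma ht_gt0 v : pos v -> v != 0 -> 0 < ht v.
Proof.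
move=> vp v0; rewrite lt_def sumr_ge0 ?andbT; last by move=> *; exact: pos_ge0.
apply: contra_neq v0 => /eqP; rewrite psumr_eq0; last by move=> *; exact: pos_ge0.
by move=> /allP h; apply: co_eq0 => j; apply/eqP/h; rewrite mem_index_enum.
Qed.

(* Induction on the height: every positive root is reached from a simple one by
   simple reflections that increase it. *)
Lemma pos_root_ind (P : E -> Prop) :
  (forall j, P (al j)) ->
  (forall j g, g \in Phi -> pos g -> ip g (al j) < 0 -> P g -> P (rf (al j) g)) ->
  forall g, g \in Phi -> pos g -> P g.
Proof.
move=> P0 P1 g gP gp; have [m] := ht_nat gp; have := leqnn m.
elim: m {-2}m g gP gp => [|N IH] m g gP gp mN hm.
  move: mN; rewrite leqn0 => /eqP m0.
  by have := ht_gt0 gp (root_neq0 gP); rewrite hm m0 ltxx.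
have [j [_ hj]] := ex_simple_gt0 (root_neq0 gP) (fun j => pos_ge0 j gp).
have [->|/eqP gj] := eqVneq g (al j); first exact: P0.
have gP' : rf (al j) g \in Phi by rewrite root_rf ?simple_root.
have gp' := rf_simple_pos gP gp gj.
rewrite -(reflectionK ip (al j) g); apply: P1 => //.
  rewrite -(reflection_ip ip (al j)) reflectionK reflection_self ?simple_neq0//.
  by rewrite ipNr oppr_lt0.
have [m' hm'] := ht_nat gp'; apply: (IH m') => //.
rewrite -ltnS; apply: leq_trans mN; rewrite -(ltr_nat R) -hm' -hm.
rewrite /reflection htD htN htZ ht_al mulr1 ltrBlDr ltrDl.
by rewrite ip_coroot_gt0 ?simple_neq0.
Qed.

(** * Words in simple reflections and the exchange property *)

Fixpoint sref (s : seq 'I_n) : E -> E :=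
  if s is j :: s' then rf (al j) \o sref s' else idfun.

Lemma sref_is_linear s : linear (sref s).
Proof. by elim: s => //= j s IH c u v; rewrite /= IH linearP. Qed.
HB.instance Definition _ s := GRing.isLinear.Build R E E _ (sref s)
  (sref_is_linear s).

Lemma sref_cat s t v : sref (s ++ t) v = sref s (sref t v).
Proof. by elim: s => //= j s ->. Qed.
Lemma sref_rcons s j v : sref (rcons s j) v = sref s (rf (al j) v).
Proof. by rewrite -cats1 sref_cat. Qed.

Lemma sref_ip s u v : ip (sref s u) (sref s v) = ip u v.
Proof. by elim: s => //= j s IH; rewrite reflection_ip. Qed.

Lemma srefVK s : cancel (sref (rev s)) (sref s).
Proof.
elim: s => [//|j s IH v] /=; rewrite rev_cons sref_rcons.
by rewrite (IH (rf (al j) v)) reflectionK.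
Qed.
Lemma srefK s : cancel (sref s) (sref (rev s)).
Proof. by move=> v; have := srefVK (rev s) v; rewrite revK. Qed.

Lemma sref_root s g : g \in Phi -> sref s g \in Phi.
Proof. by elim: s => //= j s IH gP; rewrite root_rf ?simple_root// IH. Qed.

Lemma weyl_sref s : weyl ip Phi (sref s).
Proof. by elim: s => [|j s IH]; [exact: weyl_id|apply: weyl_refl (simple_root j) IH]. Qed.

Lemma root_sref g : g \in Phi -> exists s j, g = sref s (al j).
Proof.
move=> gP; have pos_sref h : h \in Phi -> pos h -> exists s j, h = sref s (al j).
  move: h; apply: pos_root_ind => [j|j h _ _ _ [s [k ->]]]; first by exists [::], j.
  by exists (j :: s), k.
have [gp|gp] := root_sign gP; first exact: pos_sref.
have [s [j h]] := pos_sref _ (opp_root gP) gp; exists (rcons s j), j.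
by rewrite sref_rcons reflection_self ?simple_neq0// linearN/= -h opprK.
Qed.

(** The reflection in [sref t (al j)] is a conjugate of a simple one, hence itself a word. *)
Lemma weyl_srefE w : weyl ip Phi w -> exists s, w = sref s.
Proof.
elim=> [|a {}w aP _ [s ->]]; first by exists [::].
have [t [j aE]] := root_sref aP.
exists (t ++ j :: (rev t ++ s)); apply/funext => v /=.
rewrite sref_cat /= sref_cat aE -{1}(srefVK t (sref s v)).
by rewrite (reflection_isom (sref_ip t)).
Qed.

(** Reading from the right, the image of [al j] turns negative at some letter [k], which requires it
    to be [al k] just before. Conjugation then moves that letter to the right end, where it becomes
    [j]; the letters to its left are kept. *)
Lemma sref_exchange s j : pos (- sref s (al j)) ->
  exists2 s', (size s' < size s)%N & sref s =1 sref (rcons s' j).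
Proof.
elim: s => [/= h|k s IH /= h].
  by case: (root_pos_neg (simple_root j) (pos_simple j)).
have sP := sref_root s (simple_root j).
have [sp|sn] := root_sign sP; last first.
  have [s' ss' e] := IH sn; exists (k :: s') => // v.
  by rewrite /= e.
have /(contra_notP (rf_simple_pos sP sp)) se : ~ pos (rf (al k) (sref s (al j))).
  by move=> /root_pos_neg; apply => //; rewrite root_rf ?simple_root.
exists s => // v /=; rewrite -se (reflection_isom (sref_ip s)).
by rewrite sref_rcons.
Qed.

(** If the word ends in [j], the rest sends [al j] to a negative root; by exchange the rest can be
    rewritten to end in [j] as well, and the two letters cancel. *)
Lemma sref_pos_id s : (forall j, pos (sref s (al j))) -> sref s =1 id.
Proof.
move: {2}(size s) (leqnn (size s)) => N; elim: N s => [|N IH] s.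
  by rewrite leqn0 size_eq0 => /eqP->.
case: (lastP s) => [//|t j]; rewrite size_rcons ltnS => tN h.
have : pos (- sref t (al j)).
  have := h j; rewrite sref_rcons reflection_self ?simple_neq0//.
  by rewrite linearN/=.
move=> /sref_exchange[t' tt' e].
have e' : sref (rcons t j) =1 sref t'.
  by move=> v; rewrite sref_rcons e sref_rcons reflectionK.
move=> v; rewrite e'; apply: IH; first exact: leq_trans (ltnW tt') tN.
by move=> k; rewrite -e'.
Qed.

(* If (a, b) > 0, one of the two Cartan integers is 1 by Cauchy-Schwarz. *)
Lemma root_sub a b : a \in Phi -> b \in Phi -> a != b -> 0 < ip a b ->
  a - b \in Phi.
Proof.
move=> aP bP ab h.
have [x hx] := rs_int Phi_rs bP aP.
have [y hy] := rs_int Phi_rs aP bP.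
have a0 := ip_gt0 ip (root_neq0 aP); have b0 := ip_gt0 ip (root_neq0 bP).
have x0 : 0 < ip a (coroot ip b) by rewrite ip_coroot_gt0 ?root_neq0.
have y0 : 0 < ip b (coroot ip a) by rewrite ip_coroot_gt0 ?root_neq0// ipC.
have [x1|x1] := eqVneq x 1.
  by have := root_rf bP aP; rewrite /reflection hx x1 scale1r.
have [y1|y1] := eqVneq y 1.
  by have := opp_root (root_rf aP bP); rewrite /reflection hy y1 scale1r opprB.
have x2 : 2 <= ip a (coroot ip b).
  move: x0 x1; rewrite hx ltr0z => x0 x1.
  by rewrite -[2]/(2%:~R) ler_int; lia.
have y2 : 2 <= ip b (coroot ip a).
  move: y0 y1; rewrite hy ltr0z => y0 y1.
  by rewrite -[2]/(2%:~R) ler_int; lia.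
have : ip (a - b) (a - b) <= 0.
  move: x2 y2; rewrite !ip_coroot !ler_pdivlMr// !ipE (ipC ip b a).
  set p := ip a a; set q := ip b b; set r := ip a b => h1 h2; lra.
by rewrite leNgt ip_gt0// subr_eq0.
Qed.

Lemma simple_sub_pos j g : g \in Phi -> pos g -> g <> al j ->
  0 < ip g (al j) -> g - al j \in Phi /\ pos (g - al j).
Proof.
move=> gP gp gj h; have [k kj kg] := root_other_co gP gp gj.
have dP : g - al j \in Phi by rewrite root_sub ?simple_root//; exact/eqP.
split=> //; apply: (@root_co_pos _ k) => //.
by rewrite linearB/= co_al (negPf kj) subr0.
Qed.

(** * The dual simple system *)

Local Notation dal := (dual_simple ip alpha).

Lemma tnth_dual j : tnth dal j = coroot ip (al j).
Proof. by rewrite tnth_map. Qed.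

Lemma dual_simple_pos j : nncomb dal predT (coroot ip (al j)).
Proof. by rewrite -tnth_dual -[tnth _ _]mulr1n; exact: nncombMn. Qed.

Lemma co_coroot k v : co k (coroot ip v) = 2 / ip v v * co k v.
Proof. by rewrite /coroot linearZ. Qed.

Lemma co_dual (c : 'I_n -> nat) k :
  co k (\sum_j tnth dal j *+ c j) = (2 / ip (al k) (al k)) *+ c k.
Proof.
rewrite linear_sum/= (bigD1 k)//= tnth_dual linearMn/= co_coroot co_al eqxx mulr1.
rewrite big1 ?addr0// => j jk.
by rewrite tnth_dual linearMn/= co_coroot co_al eq_sym (negPf jk) mulr0 mul0rn.
Qed.

(** Reflections carry coroots to coroots, and each increasing simple reflection adds a nonnegative
    integer multiple of a simple coroot. *)
Lemma pos_coroot g : g \in Phi -> pos g -> nncomb dal predT (coroot ip g).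
Proof.
move: g; apply: pos_root_ind => [j|j g gP gp gj h]; first exact: dual_simple_pos.
rewrite (coroot_isom (reflection_ip ip (al j)))/= reflectionE -scaleNr.
have [m hm] := rs_int Phi_rs gP (simple_root j).
have gn := root_neq0 gP.
have m0 : m < 0.
  by rewrite -(ltrz0 R) -hm ip_coroot ipC mulrAC pmulr_rlt0// divr_gt0 ?ip_gt0.
have -> : - ip (coroot ip g) (al j) = (`|m|%N)%:R.
  by rewrite ipC hm -mulrNz -ltz0_abs// pmulrn.
by apply: nncombD => //; rewrite scaler_nat -tnth_dual; exact: nncombMn.
Qed.

Lemma dual_remove (c : 'I_n -> nat) j : (0 < c j)%N ->
  exists c' : 'I_n -> nat, (\sum_k c' k < \sum_k c k)%N /\
    \sum_k tnth dal k *+ c k = coroot ip (al j) + \sum_k tnth dal k *+ c' k.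
Proof.
move=> cj; exists (fun k => if k == j then (c j).-1 else c k); split.
  rewrite (bigD1 j)//= [ltnRHS](bigD1 j)//= eqxx.
  rewrite (eq_bigr c) => [|k /negPf->//].
  by rewrite -addSn prednK.
rewrite (bigD1 j)//= [in RHS](bigD1 j)//= addrA eqxx; congr (_ + _).
  by rewrite tnth_dual -mulrS prednK.
by apply: eq_bigr => k /negPf->.
Qed.

Lemma ex_dual_gt0 (c : 'I_n -> nat) v : v != 0 ->
  v = \sum_k tnth dal k *+ c k -> exists j, (0 < c j)%N /\ 0 < ip v (al j).
Proof.
move=> v0 ve; have vnn k : 0 <= co k v.
  by rewrite ve co_dual mulrn_wge0// divr_ge0// ltW// ip_gt0 ?simple_neq0.
have [j [cj hj]] := ex_simple_gt0 v0 vnn; exists j; split=> //.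
by move: cj; rewrite ve co_dual lt0n; apply: contraTneq => ->; rewrite mulr0n ltxx.
Qed.

(** The height in the basis of simple coroots: [al k] is [ip (al k) (al k) / 2] times its coroot. *)
Definition coht v := \sum_k co k v * (ip (al k) (al k) / 2).

Lemma cohtD u v : coht (u + v) = coht u + coht v.
Proof. by rewrite /coht -big_split/=; apply: eq_bigr => k _; rewrite linearD mulrDl. Qed.

Lemma cohtZ a v : coht (a *: v) = a * coht v.
Proof. by rewrite /coht mulr_sumr; apply: eq_bigr => k _; rewrite linearZ mulrA. Qed.

Lemma coht_dual (c : 'I_n -> nat) :
  coht (\sum_k tnth dal k *+ c k) = (\sum_k c k)%:R.
Proof.
rewrite /coht natr_sum; apply: eq_bigr => k _; rewrite co_dual.
have := lt0r_neq0 (ip_gt0 ip (simple_neq0 k)) => h.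
by rewrite -mulr_natr; field.
Qed.

Lemma coht_simple j : coht (coroot ip (al j)) = 1.
Proof.
have -> : coroot ip (al j) = \sum_k tnth dal k *+ (k == j).
  rewrite (bigD1 j)//= eqxx mulr1n tnth_dual big1 ?addr0// => k /negPf->.
  by rewrite mulr0n.
by rewrite coht_dual (bigD1 j)//= eqxx big1// => k /negPf->.
Qed.

(** * Lower ideals of Delta(1) and the orbit of phi *)

Section Abelian.
Variables (theta phi : E) (i : 'I_n).
Hypothesis theta_highest : is_highest_root Phi alpha theta.
Hypothesis abelian_case : co i theta = 1.
Hypothesis phi_fund : forall j, ip phi (al j) = (i == j)%:R.

Local Notation D1 := (Delta Phi alpha i 1).

Lemma ip_phi v : ip phi v = co i v.
Proof.
rewrite {1}(coE v) ip_sumr (bigD1 i)//= ipE phi_fund eqxx mulr1 big1 ?addr0//.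
by move=> j ji; rewrite ipE phi_fund eq_sym (negPf ji) mulr0.
Qed.

(** The highest root bounds the degree of every root and of its negative by 1. This is the minuscule
    property of [phi]. *)
Lemma deg_cases g : g \in Phi -> [\/ co i g = -1, co i g = 0 | co i g = 1].
Proof.
move=> gP; have le1 h : h \in Phi -> co i h <= 1.
  case: theta_highest => _ /[apply] /(pos_ge0 i).
  by rewrite linearB/= abelian_case subr_ge0.
have h1 := le1 _ gP; have := le1 _ (opp_root gP); rewrite linearN/=.
have [m] := co_int i gP; move: h1 => /[swap] ->.
rewrite -mulrNz -[1]/(1%:~R) !ler_int => h1 h2.
have [->|[->|->]] : m = -1 \/ m = 0 \/ m = 1 by lia.
- by apply: Or31; rewrite mulrNz.
- exact: Or32.
- exact: Or33.
Qed.

Lemma D1_root g : D1 g -> g \in Phi. Proof. by case. Qed.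
Lemma D1_co g : D1 g -> co i g = 1. Proof. by case. Qed.
Lemma D1_pos g : D1 g -> pos g.
Proof. by case=> gP h; apply: (@root_co_pos _ i) => //; rewrite h. Qed.

Definition W0word s := forall g, g \in Phi -> co i g = 0 -> pos g -> pos (sref s g).

Lemma W0wordP s : W0 ip Phi alpha i (sref s) <-> W0word s.
Proof.
split=> [[_ h] g gP g0 gp|h]; first by case: (h g).
split=> [|g [gP g0] [_ gp]]; first exact: weyl_sref.
by split; [rewrite sref_root|exact: h].
Qed.

(** For a word in W^0 this is all of N(w), as positive roots of degree 0 stay positive. *)
Definition neg1 s : set E := [set g | D1 g /\ pos (- sref s g)].

Lemma D1_inversions s : D1 `\` inversions Phi alpha (sref s) = D1 `\` neg1 s.
Proof.
apply/seteqP; split=> g [gD gn]; split=> //.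
  move=> [_ h]; apply: gn; split; first by split; [exact: D1_root|exact: D1_pos].
  by split=> //; rewrite opp_root// sref_root// D1_root.
by move=> [_ [_ h]]; apply: gn.
Qed.

Lemma sref_adj s u v : ip (sref s u) v = ip u (sref (rev s) v).
Proof. by rewrite -{1}(srefVK s v) sref_ip. Qed.

Lemma co_sref_rev s g : co i (sref (rev s) g) = ip (sref s phi) g.
Proof. by rewrite sref_adj ip_phi. Qed.

Lemma sref_not_simple s j g :
  g <> sref (rev s) (al j) -> sref s g <> al j.
Proof. by move=> h e; apply: h; rewrite -e srefK. Qed.

(** A degree 0 root could turn negative only if [sref s] sent it to [al j], but by hypothesis the
    preimage of [al j] has nonzero degree. *)
Lemma W0word_cons s j : W0word s -> ip (sref s phi) (al j) != 0 ->
  W0word (j :: s).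
Proof.
move=> sW h g gP g0 gp /=; apply: rf_simple_pos; [by rewrite sref_root|exact: sW|].
apply: sref_not_simple => gE; move: h.
by rewrite -co_sref_rev -gE g0 eqxx.
Qed.

(** The new letter changes the sign of no root other than [al j] and its negative. The preimage of
    [al j] has degree 1, so that of the negative has degree -1 and lies outside Delta(1). *)
Lemma neg1_cons s j : ip (sref s phi) (al j) = 1 ->
  neg1 (j :: s) = neg1 s `|` [set sref (rev s) (al j)].
Proof.
move=> h; have gD : D1 (sref (rev s) (al j)).
  by split; [rewrite sref_root ?simple_root|rewrite co_sref_rev h].
have h2 g : D1 g -> sref s (- g) <> al j.
  move=> [_ g1]; apply: sref_not_simple => gE.
  have := D1_co gD; rewrite -gE linearN/= g1 => /eqP.
  by rewrite -subr_eq0 -opprD oppr_eq0 (_ : 1%:~R + 1 = 2)// pnatr_eq0.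
apply/seteqP; split=> g.
  move=> [gD' /= gn]; have [gE|gE] := pselect (g = sref (rev s) (al j)).
    by right.
  left; split=> //; have sP : sref s g \in Phi by rewrite sref_root// D1_root.
  apply: root_not_pos => // sp; apply: (root_pos_neg _ _ gn).
    by rewrite root_rf ?simple_root.
  by apply: rf_simple_pos => //; exact: sref_not_simple.
move=> [[gD' gn]|->]; split=> //=; last first.
  by rewrite srefVK reflection_self ?simple_neq0// opprK; exact: pos_simple.
rewrite -linearN/= -linearN/=; apply: rf_simple_pos.
- by rewrite sref_root// opp_root// D1_root.
- by rewrite linearN.
- exact: h2.
Qed.

Lemma ip_orbit_cases s g : g \in Phi ->
  [\/ ip (sref s phi) g = -1, ip (sref s phi) g = 0 | ip (sref s phi) g = 1].
Proof. by move=> gP; rewrite -co_sref_rev; apply: deg_cases; rewrite sref_root. Qed.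

Lemma rf_orbit s j : rf (al j) (sref s phi) =
  sref s phi - ip (sref s phi) (al j) *: coroot ip (al j).
Proof. exact: reflectionE. Qed.

(** Dropping the letters that fix the current orbit point keeps the word in W^0. *)
Lemma orbit_W0word s : exists2 t, W0word t & sref t phi = sref s phi.
Proof.
elim: s => [|j s [t tW e]]; first by exists [::].
have [h|h] := eqVneq (ip (sref t phi) (al j)) 0.
  by exists t => //=; rewrite -e rf_orbit h scale0r subr0.
by exists (j :: t); [exact: W0word_cons|rewrite /= e].
Qed.

(** It suffices that s t^-1 keeps each simple root positive. The root g = t^-1 (al k) has degree -1,
    0 or 1; in degree 0 the W^0 conditions fix the sign of s g, otherwise the equality of the two
    sets does. *)
Lemma neg1_inj s t : W0word s -> W0word t -> neg1 s = neg1 t ->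
  sref s =1 sref t.
Proof.
move=> sW tW st; have : forall k, pos (sref (s ++ rev t) (al k)).
  move=> k; rewrite sref_cat; set g := sref (rev t) (al k).
  have gP : g \in Phi by rewrite sref_root// simple_root.
  have tg : sref t g = al k by rewrite srefVK.
  have kn := root_pos_neg (simple_root k) (pos_simple k).
  have [g1|g0|g1] := deg_cases gP.
  - suff : neg1 s (- g) by case=> _; rewrite linearN/= opprK.
    rewrite st; split; last by rewrite linearN/= opprK tg; exact: pos_simple.
    by split; [exact: opp_root|rewrite linearN/= g1 opprK].
  - apply: sW => //; apply: contrapT => /(root_not_pos gP) gn; apply: kn.
    by rewrite -tg -linearN; apply: tW => //; rewrite ?opp_root// linearN/= g0 oppr0.
  - apply: contrapT => /(root_not_pos (sref_root s gP)) gn; apply: kn.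
    have : neg1 s g by [].
    by rewrite st -tg => -[].
by move=> /sref_pos_id h v; rewrite -(h (sref t v)) sref_cat srefK.
Qed.

(** s^-1 t fixes [phi], hence preserves degrees. It keeps [al i] in degree 1, so positive; on the
    other simple roots the W^0 conditions for s and t exclude a sign change. *)
Lemma orbit_inj s t : W0word s -> W0word t -> sref s phi = sref t phi ->
  sref s =1 sref t.
Proof.
move=> sW tW st; have u1 : sref (rev s ++ t) phi = phi.
  by rewrite sref_cat -st srefK.
have deg v : co i (sref (rev s ++ t) v) = co i v.
  by rewrite -!ip_phi -{1}u1 sref_ip.
have : forall k, pos (sref (rev s ++ t) (al k)).
  move=> k; have uP := sref_root (rev s ++ t) (simple_root k).
  have [ki|ki] := eqVneq k i.
    by apply: (@root_co_pos _ i) => //; rewrite deg ki co_al eqxx.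
  apply: contrapT => /(root_not_pos uP) un.
  have k0 : co i (al k) = 0 by rewrite co_al eq_sym (negPf ki).
  have : pos (sref s (- sref (rev s ++ t) (al k))).
    by apply: sW => //; rewrite ?opp_root// linearN/= deg k0 oppr0.
  rewrite linearN/= sref_cat srefVK; apply: root_pos_neg.
    by rewrite sref_root ?simple_root.
  by apply: tW => //; rewrite ?simple_root//; exact: pos_simple.
move=> /sref_pos_id h v; have := congr1 (sref s) (h v).
by rewrite sref_cat srefVK.
Qed.

Lemma neg1_ext s t : sref s =1 sref t -> neg1 s = neg1 t.
Proof. by move=> h; apply/seteqP; split=> g []; rewrite /neg1/= h. Qed.

(** Induction on the number of simple coroots in the difference. Some [al j] whose coroot occurs
    there pairs positively with it. As orbit points pair to -1, 0 or 1 with roots, either the upper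
    point pairs to 1 and can be lowered, or the lower one pairs to -1 and can be raised. Either move
    uses up that coroot and changes one set by one root. *)
Lemma orbit_le_neg1 s t : W0word s -> W0word t ->
  nncomb dal predT (sref t phi - sref s phi) -> neg1 t `<=` neg1 s.
Proof.
move=> sW tW [c]; have := leqnn (\sum_j c j)%N.
move: {2}(\sum_j c j)%N => N; elim: N s t c sW tW => [|N IH] s t c sW tW cN ce.
  rewrite (neg1_ext (orbit_inj sW tW _))//; apply/eqP.
  rewrite eq_sym -subr_eq0 ce big1// => j _.
  move: cN; rewrite leqn0 sum_nat_eq0 => /forallP/(_ j)/eqP->.
  by rewrite mulr0n.
have [d0|d0] := eqVneq (sref t phi - sref s phi) 0.
  rewrite (neg1_ext (orbit_inj sW tW _))//; apply/eqP.
  by rewrite eq_sym -subr_eq0 d0.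
have [j [cj hj]] := ex_dual_gt0 d0 ce; have [c' [c'c cE]] := dual_remove cj.
have c'N : (\sum_k c' k <= N)%N by rewrite -ltnS (leq_trans c'c).
have jP := simple_root j.
have [tj1|tj1] := eqVneq (ip (sref t phi) (al j)) 1.
  have tW' : W0word (j :: t) by apply: W0word_cons => //; rewrite tj1 oner_eq0.
  apply: subset_trans (IH s (j :: t) c' sW tW' c'N _).
    by rewrite neg1_cons//; exact: subsetUl.
  by rewrite /= rf_orbit tj1 scale1r addrAC ce cE addrC addKr.
have sj1 : ip (sref s phi) (al j) = -1.
  move: hj tj1; rewrite !ipE => hj.
  case: (ip_orbit_cases t jP) hj => ->; case: (ip_orbit_cases s jP) => -> //;
    rewrite ?eqxx//; lra.
have sW' : W0word (j :: s).
  by apply: W0word_cons => //; rewrite sj1 oppr_eq0 oner_eq0.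
apply: subset_trans (IH (j :: s) t c' sW' tW c'N _) _.
  by rewrite /= rf_orbit sj1 scaleN1r opprK opprD addrA ce cE addrC addKr.
(* [neg1_cons] describes lowering only, so s is viewed as the raised word lowered back by [j]. *)
have sE : sref s =1 sref [:: j, j & s] by move=> v /=; rewrite reflectionK.
rewrite (neg1_ext sE) (@neg1_cons (j :: s)) ?[sref _ _]/=; first exact: subsetUl.
by rewrite -(reflection_ip ip (al j)) reflectionK reflection_self ?simple_neq0//
  ipNr sj1 opprK.
Qed.

(** * Lower sets and antichains of Delta(1) *)

Local Notation le1 := (le1 alpha i).

Lemma le1P mu g : le1 mu g <-> pos (g - mu) /\ co i (g - mu) = 0.
Proof.
split=> [h|[/posP gp g0]]; first split; first exact: nncomb_pos h.
  by move: h => /nncombP/(_ i)[_]; apply; rewrite /= eqxx.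
by apply/nncombP => j; split=> //= /negPn/eqP->.
Qed.

Lemma le1_refl g : le1 g g.
Proof. by rewrite /Defs.le1 subrr; exact: nncomb0. Qed.

Lemma le1_trans g h k : le1 g h -> le1 h k -> le1 g k.
Proof. by rewrite /Defs.le1 => gh hk; rewrite -(subrK h k) -addrA; exact: nncombD. Qed.

Lemma le1_anti g h : le1 g h -> le1 h g -> g = h.
Proof.
move=> /le1P[gh _] /le1P[hg _]; apply/esym/eqP; rewrite -subr_eq0.
by rewrite (pos_anti gh)// opprB.
Qed.

Lemma le1_ht mu g : le1 mu g -> mu != g -> ht mu < ht g.
Proof.
move=> /le1P[gp _] mg; rewrite -subr_gt0 -htN -htD.
by apply: ht_gt0 => //; rewrite subr_eq0 eq_sym.
Qed.

Definition lower_set (M : set E) := M `<=` D1 /\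
  forall mu g, D1 mu -> M g -> le1 mu g -> M mu.

(** g - mu is a sum of simple roots other than [al i], all of which the word keeps positive. *)
Lemma neg1_lower s : W0word s -> lower_set (neg1 s).
Proof.
move=> sW; split=> [g []//|mu g muD [gD gn] /nncombP h]; split=> //.
have -> : - sref s mu = - sref s g + sref s (g - mu).
  by rewrite linearB/= addKr.
apply: nncombD => //; rewrite (coE (g - mu)) linear_sum/=.
apply: (big_ind pos) => [||k _]; [exact: nncomb0|exact: nncombD|].
have [[m hm] h0] := h k; rewrite linearZ/=.
have [ki|ki] := eqVneq k i.
  by rewrite h0 ?ki ?scale0r /= ?eqxx//; exact: nncomb0.
rewrite hm scaler_nat; elim: m {hm} => [|m IH]; first exact: nncomb0.
rewrite mulrS; apply: nncombD => //; apply: sW; first exact: simple_root.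
  by rewrite co_al eq_sym (negPf ki).
exact: pos_simple.
Qed.

(** If nu had degree 0, it would be positive because s nu is. Then mu would be a degree 1 root
    strictly below the sum, so s mu would be negative. *)
Lemma lower_root_summand s mu nu : W0word s -> mu \in Phi -> nu \in Phi ->
  D1 (mu + nu) -> pos (sref s mu) -> pos (sref s nu) ->
  (forall a, D1 a -> le1 a (mu + nu) -> a != mu + nu -> neg1 s a) ->
  co i nu <> 0.
Proof.
move=> sW muP nuP [_ gD] smu snu h nu0.
have nup : pos nu.
  apply: contrapT => /(root_not_pos nuP) nun.
  apply: (root_pos_neg (sref_root s nuP) snu).
  by rewrite -linearN; apply: sW => //; rewrite ?opp_root// linearN/= nu0 oppr0.
have [] : neg1 s mu; last by move=> _; apply: root_pos_neg; rewrite ?sref_root.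
apply: h.
- by split=> //; rewrite -gD linearD/= nu0 addr0.
- by apply/le1P; rewrite addrC addKr.
- by rewrite -{1}(addr0 mu) (inj_eq (addrI _)) eq_sym root_neq0.
Qed.

(** Otherwise s g is a sum of two positive roots. By the preceding lemma their preimages have
    degrees 1 or -1, and two such numbers never add up to the degree 1 of g. *)
Lemma step_simple s g : W0word s -> D1 g -> ~ neg1 s g ->
  (forall mu, D1 mu -> le1 mu g -> mu != g -> neg1 s mu) ->
  exists j, sref s g = al j.
Proof.
move=> sW gD gn h; have gP := D1_root gD; have bP := sref_root s gP.
have bp : pos (sref s g) by apply: contrapT => /(root_not_pos bP) ?; apply: gn.
have [j [_ bj]] := ex_simple_gt0 (root_neq0 bP) (fun k => pos_ge0 k bp).
have [bE|bE] := pselect (sref s g = al j); first by exists j.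
have [dP dp] := simple_sub_pos bP bp bE bj.
have srefV := srefVK s; have jP := simple_root j.
pose mu := sref (rev s) (sref s g - al j); pose nu := sref (rev s) (al j).
have gE : g = mu + nu by rewrite /mu linearB/= srefK subrK.
have muP : mu \in Phi by rewrite sref_root.
have nuP : nu \in Phi by rewrite sref_root.
have smu : pos (sref s mu) by rewrite srefV.
have snu : pos (sref s nu) by rewrite srefV; exact: pos_simple.
have nu0 : co i nu <> 0.
  by apply: (lower_root_summand sW muP nuP _ smu snu); rewrite -gE.
have mu0 : co i mu <> 0.
  by apply: (lower_root_summand sW nuP muP _ snu smu); rewrite addrC -gE.
have := D1_co gD; rewrite gE linearD/=.
case: (deg_cases muP) => // ->; case: (deg_cases nuP) => // -> /eqP; last 1 first.
- by rewrite -subr_eq0 addrK oner_eq0.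
- by rewrite -subr_eq0 (_ : -1 - 1 - 1%:~R = - 3%:R) ?oppr_eq0 ?pnatr_eq0//; lra.
- by rewrite addNr eq_sym oner_eq0.
- by rewrite subrr eq_sym oner_eq0.
Qed.

(* Adding to neg1 s a root g of minimal height in its complement in M: then
   s g is simple, and the corresponding simple reflection extends s. *)
Lemma lower_set_neg1 s M : W0word s -> lower_set M -> neg1 s `<=` M ->
  exists t, [/\ W0word t, neg1 t = M &
    nncomb dal predT (sref s phi - sref t phi)].
Proof.
pose q s := fun g => `[< M g /\ ~ neg1 s g >].
have := leqnn (count (q s) Phi); move: {2}(count (q s) Phi) => N.
elim: N s => [|N IH] s sN sW Ml sM.
all: have [[g [Mg ng]]|hn] := pselect (exists g, M g /\ ~ neg1 s g); last first.
1,3: exists s; split=> //; last by rewrite subrr; exact: nncomb0.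
1,2: apply/seteqP; split=> // g Mg; apply: contrapT => ng; apply: hn; by exists g.
all: have gP : g \in Phi by apply: D1_root; apply: Ml.1.
  move: sN; rewrite leqn0 -leqn0 leqNgt -has_count => /hasPn/(_ g gP)/asboolP.
  by case.
have [g0 [gP0 [Mg0 ng0] hmin]] :=
  ex_argmin (P := fun g => M g /\ ~ neg1 s g) ht gP (conj Mg ng).
have gD0 := Ml.1 _ Mg0.
have [j jE] : exists j, sref s g0 = al j.
  apply: step_simple => // mu muD le mug; apply: contrapT => nmu.
  have := hmin mu (D1_root muD) (conj (Ml.2 _ _ muD Mg0 le) nmu).
  by rewrite leNgt le1_ht.
have g0E : g0 = sref (rev s) (al j) by rewrite -jE srefK.
have h : ip (sref s phi) (al j) = 1.
  by rewrite -co_sref_rev -g0E; exact: D1_co.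
have sW' : W0word (j :: s) by apply: W0word_cons => //; rewrite h oner_eq0.
have nE := neg1_cons h; rewrite -g0E in nE.
have [||//||t [tW tM le]] := IH (j :: s).
- rewrite -ltnS; apply: leq_trans sN; apply: (ltn_count _ gP0).
  + move=> x /asboolP[Mx nx]; apply/asboolP; split=> // sx; apply: nx.
    by rewrite nE; left.
  + exact/asboolP.
  + by apply/asboolP => -[_]; apply; rewrite nE; right.
- exact: sW'.
- by rewrite nE => x [/sM//|->].
exists t; split=> //.
have -> : sref s phi - sref t phi =
    coroot ip (al j) + (sref (j :: s) phi - sref t phi).
  by rewrite [sref (j :: s) phi]/= rf_orbit h scale1r [in RHS]addrAC [RHS]addrC
     subrK.
by apply: nncombD => //; exact: dual_simple_pos.
Qed.

Local Notation Gam s := (Gamma Phi alpha i (sref s)).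
Local Notation up_ideal := (upper_ideal Phi alpha i).

(** An element of least height among those of [U] below g is minimal in [U]. *)
Lemma upper_ideal_min U : U `<=` D1 ->
  (forall mu g, D1 g -> U mu -> le1 mu g -> U g) -> up_ideal (min1 alpha i U) = U.
Proof.
move=> UD Uup; apply/seteqP; split=> g.
  by move=> [gD [mu [Umu _] le]]; exact: Uup le.
move=> Ug; split; first exact: UD.
have [m [mP [Um le] hm]] :=
  ex_argmin (P := fun m => U m /\ le1 m g) ht (D1_root (UD _ Ug)) (conj Ug (le1_refl g)).
exists m => //; split=> // mu Umu lemu; apply/eqP; apply: contraT => mum.
have := hm mu (D1_root (UD _ Umu)) (conj Umu (le1_trans lemu le)).
by rewrite leNgt le1_ht.
Qed.

Lemma upper_ideal_Gamma s : W0word s -> up_ideal (Gam s) = D1 `\` neg1 s.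
Proof.
move=> sW; rewrite /Gamma D1_inversions upper_ideal_min => [//|g []//|].
move=> mu g gD [muD nmu] le; split=> // gn; apply: nmu.
exact: (neg1_lower sW).2 le.
Qed.

Lemma Gamma_antichain s : antichains Phi alpha i (Gam s).
Proof.
split=> [g [[]]//|mu g [mu1 _] [_ h] le]; exact: h.
Qed.

(** The complement of the ideal generated by [G] is a lower set, so it can be reached from the empty
    word, whose [neg1] is empty. *)
Lemma antichain_Gamma G : antichains Phi alpha i G ->
  exists2 s, W0word s & G = Gam s.
Proof.
move=> [GD Ganti]; pose M := D1 `\` up_ideal G.
have Ml : lower_set M.
  split=> [g []//|mu g muD [gD ng] le]; split=> // -[_ [a Ga le']].
  by apply: ng; split=> //; exists a => //; exact: le1_trans le.
have n0 : neg1 [::] `<=` M.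
  by move=> g [gD] /= /(root_pos_neg (D1_root gD) (D1_pos gD)).
have [//|s [sW sM _]] := lower_set_neg1 _ Ml n0.
exists s => //; rewrite /Gamma D1_inversions sM.
have -> : D1 `\` M = up_ideal G.
  apply/seteqP; split=> g; first by move=> [gD nM]; apply: contrapT => h; apply: nM.
  by move=> h; split; [case: h|move=> [_]; apply].
apply/seteqP; split=> g.
  move=> Gg; split; first by split; [exact: GD|exists g => //; exact: le1_refl].
  move=> mu [_ [a Ga le]] le'; apply: (le1_anti le').
  by rewrite -(Ganti a g Ga Gg (le1_trans le le')).
move=> [[gD [a Ga le]] h].
by rewrite -(h a)//; split; [exact: GD|exists a => //; exact: le1_refl].
Qed.

(** Two reversals cancel: a larger ideal has a smaller complement [neg1], and a smaller [neg1] means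
    a higher orbit point. *)
Lemma Gamma_le s t : W0word s -> W0word t ->
  (le_up Phi alpha i (Gam s) (Gam t) <->
   root_le dal (sref s phi) (sref t phi)).
Proof.
move=> sW tW; rewrite /le_up !upper_ideal_Gamma//.
have nn : D1 `\` neg1 s `<=` D1 `\` neg1 t <-> neg1 t `<=` neg1 s.
  split=> h g.
    move=> gt; apply: contrapT => gs; have gD : D1 g by case: gt.
    by have [] := h g (conj gD gs).
  by move=> [gD gs]; split=> // /h.
split=> [/nn h|h]; last by apply/nn; exact: orbit_le_neg1.
have [u [uW uE le]] := lower_set_neg1 tW (neg1_lower sW) h.
by rewrite /root_le -(neg1_inj uW sW uE).
Qed.

Theorem antichains_orbit : exists f : set E -> E,
    [/\ forall w, W0 ip Phi alpha i w ->
          antichains Phi alpha i (Gamma Phi alpha i w) /\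
          f (Gamma Phi alpha i w) = w phi,
        forall G, antichains Phi alpha i G ->
          exists2 w, W0 ip Phi alpha i w & G = Gamma Phi alpha i w,
        set_bij (antichains Phi alpha i) [set sref s phi | s in setT] f &
        forall G G', antichains Phi alpha i G -> antichains Phi alpha i G' ->
          (le_up Phi alpha i G G' <-> root_le dal (f G) (f G'))].
Proof.
(* The default 0 is taken only off the antichains. On them the value is unique: [Gamma] determines
   its ideal, hence [neg1], hence the map [sref s]. *)
pose f G := xget 0 [set v | exists s, [/\ W0word s, G = Gam s & v = sref s phi]].
have GamI s t : W0word s -> W0word t -> Gam s = Gam t -> neg1 s = neg1 t.
  move=> sW tW e; have := upper_ideal_Gamma sW; rewrite e upper_ideal_Gamma// => e'.
  apply/seteqP; split=> g gn; have gD : D1 g by [case: gn];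
    apply: contrapT => gn'.
    have : (D1 `\` neg1 t) g by [].
    by rewrite e' => -[].
  have : (D1 `\` neg1 s) g by [].
  by rewrite -e' => -[].
have fE s : W0word s -> f (Gam s) = sref s phi.
  move=> sW; rewrite /f; case: xgetP => [v _ [t [tW e ->]]|/(_ (sref s phi))].
    by rewrite (neg1_inj tW sW)//; apply: GamI.
  by case; exists s.
exists f; split.
- move=> w wW; have [ww _] := wW; have [s sE] := weyl_srefE ww.
  rewrite sE in wW *; split; first exact: Gamma_antichain.
  by apply: fE; apply/W0wordP.
- move=> G /antichain_Gamma[s sW ->]; exists (sref s) => //.
  exact/W0wordP.
- split.
  + by move=> G /antichain_Gamma[s sW ->]; rewrite /= fE//; exists s.
  + move=> G G' /set_mem/antichain_Gamma[s sW ->] /set_mem/antichain_Gamma[t tW ->].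
    rewrite !fE// => /(orbit_inj sW tW) e.
    by rewrite /Gamma !D1_inversions (neg1_ext e).
  + move=> v [s _ <-]; have [t tW <-] := orbit_W0word s.
    by exists (Gam t); [exact: Gamma_antichain|exact: fE].
- move=> G G' /antichain_Gamma[s sW ->] /antichain_Gamma[t tW ->].
  by rewrite !fE//; exact: Gamma_le.
Qed.

(* As phi is minuscule, a point s phi lying strictly above nu can be lowered
   by one simple coroot while staying in the orbit. *)
Lemma dominant_orbit nu s : (forall j, 0 <= ip nu (al j)) ->
  nncomb dal predT (sref s phi - nu) -> exists t, nu = sref t phi.
Proof.
move=> dom [c]; have := leqnn (\sum_j c j)%N.
move: {2}(\sum_j c j)%N => N; elim: N s c => [|N IH] s c cN ce.
all: have [d0|d0] := eqVneq (sref s phi - nu) 0;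
  first by exists s; apply/esym/eqP; rewrite -subr_eq0 d0.
all: have [j [cj hj]] := ex_dual_gt0 d0 ce; have [c' [c'c cE]] := dual_remove cj.
  by have := leq_trans c'c cN; rewrite ltn0.
have sj1 : ip (sref s phi) (al j) = 1.
  move: hj; rewrite !ipE; have := dom j.
  by case: (ip_orbit_cases s (simple_root j)) => -> //; lra.
apply: (IH (j :: s) c'); first by rewrite -ltnS (leq_trans c'c).
by rewrite /= rf_orbit sj1 scale1r addrAC ce cE addrC addKr.
Qed.

(* Reflecting along a simple root with negative pairing moves nu closer to phi,
   so the dominant case is reached after finitely many steps. *)
Lemma saturated_orbit (P : E -> Prop) :
  (forall nu j, P nu -> (exists m : int, ip nu (al j) = m%:~R) /\
     P (rf (al j) nu)) ->
  (forall nu, P nu -> nncomb dal predT (phi - nu)) ->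
  forall nu, P nu -> exists t, nu = sref t phi.
Proof.
move=> Prf Ple nu Pnu; have [c ce] := Ple _ Pnu.
have := leqnn (\sum_j c j)%N; move: {2}(\sum_j c j)%N => N.
elim: N nu c Pnu ce => [|N IH] nu c Pnu ce cN.
all: have [dom|] := pselect (forall j, 0 <= ip nu (al j));
  first exact: (@dominant_orbit nu [::] dom (Ple _ Pnu)).
all: move=> /existsNP[j /negP]; rewrite -ltNge => hj.
all: have [_ Pnu'] := Prf _ j Pnu; have [c' ce'] := Ple _ Pnu'.
all: have lt : (\sum_k c' k < \sum_k c k)%N.
1,3: rewrite -(ltr_nat R) -!coht_dual -ce -ce' reflectionE opprB addrA addrAC.
1,2: by rewrite cohtD cohtZ coht_simple mulr1 gtrDl.
  by have := leq_trans lt cN; rewrite ltn0.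
have [|t tE] := IH _ _ Pnu' ce'; first by rewrite -ltnS (leq_trans lt).
by exists (j :: t); rewrite /= -tE reflectionK.
Qed.

End Abelian.
End SimpleSystem.

(** * Weights and sl_2-triples *)

Local Open Scope complex_scope.

Section Action.
Variables (R : realType) (L V : vectType R[i]) (act : {bilinear L -> V -> V}).

Lemma actDr x u v : act x (u + v) = act x u + act x v.
Proof. exact: linearDr. Qed.
Lemma actZr a x u : act x (a *: u) = a *: act x u.
Proof. exact: linearZr_LR. Qed.
Lemma actDl x y u : act (x + y) u = act x u + act y u.
Proof. exact: linearDl. Qed.
Lemma actZl a x u : act (a *: x) u = a *: act x u.
Proof. exact: linearZl_LR. Qed.
Lemma act0r x : act x 0 = 0. Proof. exact: linear0r. Qed.
Lemma act0l u : act 0 u = 0. Proof. exact: linear0l. Qed.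
Lemma actNr x u : act x (- u) = - act x u. Proof. exact: linearNr. Qed.
Lemma act_sumr I (r : seq I) (P : pred I) (F : I -> V) x :
  act x (\sum_(j <- r | P j) F j) = \sum_(j <- r | P j) act x (F j).
Proof. by apply: (big_morph (act x)) => [u v|]; rewrite ?actDr ?act0r. Qed.
Lemma act_suml I (r : seq I) (P : pred I) (F : I -> L) u :
  act (\sum_(j <- r | P j) F j) u = \sum_(j <- r | P j) act (F j) u.
Proof. by apply: (big_morph (act^~ u)) => [x y|]; rewrite ?actDl ?act0l. Qed.
End Action.

Section Weights.
Variables (R : realType) (E : vectType R) (ip : {dot E for idfun}).
Variables (L V : vectType R[i]) (act : {bilinear L -> V -> V}) (rho : E -> L).
Local Notation C := R[i].
Local Notation wt := (weight_space ip act rho).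
Local Notation weights := (weights ip act rho).

Lemma wt0 nu : wt nu 0.
Proof. by move=> x; rewrite act0r scaler0. Qed.
Lemma wtD nu u v : wt nu u -> wt nu v -> wt nu (u + v).
Proof. by move=> hu hv x; rewrite actDr hu hv scalerDr. Qed.
Lemma wtZ nu a u : wt nu u -> wt nu (a *: u).
Proof. by move=> hu x; rewrite actZr hu !scalerA mulrC. Qed.

Lemma wt_indep (s : seq E) (z : E -> V) : uniq s ->
  (forall nu, nu \in s -> wt nu (z nu)) -> \sum_(nu <- s) z nu = 0 ->
  forall nu, nu \in s -> z nu = 0.
Proof.
elim: s z => // a s IH z /=/andP[as_ us] hz; rewrite big_cons => e.
have zs nu : nu \in s -> z nu = 0.
  (* Applying [rho x] and subtracting [ip a x] times the relation removes the term at [a]. With this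
     [x] the coefficient left at [nu] is [ip x x], which is nonzero. *)
  move=> nus; pose x := nu - a.
  have h : \sum_(mu <- s) (ip (mu - a) x)%:C *: z mu = 0.
    have := congr1 (act (rho x)) e; rewrite actDr act0r act_sumr.
    rewrite hz ?mem_head// (eq_big_seq (fun mu => (ip mu x)%:C *: z mu)); last first.
      by move=> mu mus; rewrite hz// inE mus orbT.
    move/eqP: e; rewrite addr_eq0 => /eqP->; rewrite scalerN scaler_sumr addrC.
    rewrite -sumrB => e2; rewrite -[RHS]e2; apply: eq_bigr => mu _.
    by rewrite -scalerBl ipDl ipNl rmorphB.
  have /(_ nu nus)/eqP : forall mu, mu \in s -> (ip (mu - a) x)%:C *: z mu = 0.
    by apply: IH => // mu mus; apply/wtZ/hz; rewrite inE mus orbT.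
  rewrite scaler_eq0 -(rmorph0 (real_complex R)) (inj_eq (@complexI R)).
  rewrite ip_eq0 subr_eq0 => /orP[/eqP nua|/eqP//].
  by rewrite nua (negPf as_) in nus.
move=> nu; rewrite inE => /orP[/eqP->|]; last exact: zs.
by move: e; rewrite big_seq big1 ?addr0// => mu; exact: zs.
Qed.

Lemma weights_size (s : seq E) : uniq s -> (forall nu, nu \in s -> weights nu) ->
  (size s <= \dim {:V})%N.
Proof.
move=> us ws; have ex nu : exists v, nu \in s -> wt nu v /\ v != 0.
  have [/ws[v v0 hv]|_] := boolP (nu \in s); last by exists 0.
  by exists v.
have [z hz] := choice ex.
have fX : free (map z s).
  rewrite -[map z s]/(tval (map_tuple z (in_tuple s))).
  apply/freeP => k h; pose c nu := if insub (index nu s) is Some j then k j else 0.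
  have cE (j : 'I_(size s)) : c s`_j = k j.
    by rewrite /c index_uniq// insubT//= => lt; congr k; apply: val_inj.
  have zE (j : 'I_(size s)) : (map z s)`_j = z s`_j by rewrite (nth_map 0).
  have e : \sum_(nu <- s) c nu *: z nu = 0.
    rewrite (big_nth 0) big_mkord -[RHS]h; apply: eq_bigr => j _.
    by rewrite cE zE.
  move=> j; have js : s`_j \in s by rewrite mem_nth.
  have := wt_indep us (fun nu nus => wtZ (c nu) (hz nu nus).1) e js.
  by move=> /eqP; rewrite scaler_eq0 (negPf (hz _ js).2) orbF cE => /eqP.
by rewrite -(size_map z) -(eqP fX) dimvS ?subvf.
Qed.

Lemma weights_finite : exists2 s : seq E, uniq s & forall nu, weights nu -> nu \in s.
Proof.
apply: contrapT => h.
have : exists s : seq E, [/\ uniq s, size s = (\dim {:V}).+1 &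
    forall nu, nu \in s -> weights nu].
  elim: (\dim {:V}).+1 => [|k [s [us sk ws]]]; first by exists [::].
  have [nu wnu nus] : exists2 nu, weights nu & nu \notin s.
    apply: contrapT => h'; apply: h; exists s => // nu wnu.
    by apply: contraT => nus; case: h'; exists nu.
  exists (nu :: s); split; rewrite /= ?nus ?sk// => mu.
  by rewrite inE => /orP[/eqP->|/ws].
by move=> [s [us sk /(weights_size us)]]; rewrite sk ltnn.
Qed.

(** The iterates have pairwise distinct weights, and only finitely many weight spaces are
    nonzero. *)
Lemma shift_nilp x b nu u : b != 0 ->
  (forall nu u, wt nu u -> wt (nu + b) (act x u)) -> wt nu u ->
  exists p, iter p (act x) u = 0.
Proof.
move=> b0 sh hu; have [s us ws] := weights_finite.
have [|k ks] := @finite_escape _ s (fun k => nu + b *+ k).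
  move=> j k /addrI/eqP; rewrite -!scaler_nat -subr_eq0 -scalerBl scaler_eq0.
  by rewrite (negPf b0) orbF subr_eq0 eqr_nat => /eqP.
have hk : wt (nu + b *+ k) (iter k (act x) u).
  elim: k {ks} => [|k IH]; first by rewrite addr0.
  by rewrite mulrSr addrA; exact: sh.
exists k; apply/eqP; apply: contraT => v0.
by rewrite ws in ks => //; exists (iter k (act x) u).
Qed.

(** * Weight strings for sl_2 *)

Section Sl2.
Variables (e f : L) (b : E) (hv : E -> C).
Hypothesis b0 : b != 0.
Hypothesis eshift : forall nu u, wt nu u -> wt (nu + b) (act e u).
Hypothesis fshift : forall nu u, wt nu u -> wt (nu - b) (act f u).
Hypothesis comm : forall nu u, wt nu u ->
  act e (act f u) = act f (act e u) + hv nu *: u.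
Hypothesis hvb : forall nu, hv (nu + b) = hv nu + 2.

Lemma hv_add nu p : hv (nu + b *+ p) = hv nu + p%:R * 2.
Proof.
elim: p => [|p IH]; first by rewrite mul0r !addr0.
by rewrite mulrSr addrA hvb IH; ring.
Qed.

Lemma hv_sub nu p : hv (nu - b *+ p) = hv nu - p%:R * 2.
Proof. by rewrite -{2}(subrK (b *+ p) nu) hv_add addrK. Qed.

Lemma wt_lower nu u p : wt nu u -> wt (nu - b *+ p) (iter p (act f) u).
Proof.
move=> hu; elim: p => [|p IH]; first by rewrite subr0.
by rewrite mulrSr opprD addrA; exact: fshift.
Qed.

Lemma sl2_lower lam v p : wt lam v -> act e v = 0 ->
  act e (iter p.+1 (act f) v) =
  (p.+1%:R * (hv lam - p%:R)) *: iter p (act f) v.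
Proof.
move=> hl ev; elim: p => [|p IH].
  by rewrite /= (comm hl) ev act0r add0r subr0 mul1r.
rewrite iterS (comm (wt_lower p.+1 hl)) IH actZr -iterS -scalerDl hv_sub.
congr (_ *: _); ring.
Qed.

(** Here [hv] is the eigenvalue of h as an abstract function of the weight, so that e and f may be
    exchanged and [hv] negated. Raising v by p steps gives w killed by e; if f kills w after exactly
    k + 1 steps, then h has eigenvalue k on w and k - 2p on v. When this is nonnegative, lowering w
    by k - p steps gives a nonzero vector of the reflected weight. *)
Lemma sl2_string nu : weights nu -> exists m : int, hv nu = m%:~R /\
  (0 <= m -> weights (nu - m%:~R *: b)).
Proof.
move=> [v v0 hv_].
have [p [/eqP ep pmin]] := ex_least (shift_nilp b0 eshift hv_).
case: p ep pmin => [|p] ep pmin; first by rewrite (negPf v0) in ep.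
pose lam := nu + b *+ p; pose w := iter p (act e) v.
have w0 : w <> 0 by apply: pmin.
have hw : wt lam w.
  rewrite /lam /w; elim: (p) => [|k IH]; first by rewrite addr0.
  by rewrite mulrSr addrA; exact: eshift.
have nb0 : - b != 0 by rewrite oppr_eq0.
have [k [ek kmin]] := ex_least (shift_nilp nb0 fshift hw).
case: k ek kmin => [//|k] ek kmin.
have := sl2_lower k hw (eqP ep); rewrite ek act0r => /esym/eqP.
rewrite scaler_eq0 => /orP[|/eqP h]; last by case: (kmin k).
rewrite mulf_eq0 pnatr_eq0/= subr_eq0 hv_add => /eqP hk.
have hnu : hv nu = (k%:Z - (p * 2)%:Z)%:~R.
  by rewrite rmorphB/= -!pmulrn -hk natrM addrK.
exists (k%:Z - (p * 2)%:Z); split=> // m0.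
have pk : (p <= k)%N by lia.
exists (iter (k - p) (act f) w).
  by apply/eqP/kmin; rewrite ltnS leq_subr.
have -> : nu - (k%:Z - (p * 2)%:Z)%:~R *: b = lam - b *+ (k - p).
  rewrite /lam -!scaler_nat -addrA -scalerBl -scaleNr; congr (_ + _ *: _).
  rewrite rmorphB/= -!pmulrn natrB// natrM; ring.
exact: wt_lower.
Qed.
End Sl2.

End Weights.

Section WeightSums.
Variables (R : realType) (E : vectType R) (ip : {dot E for idfun}).
Variables (L V : vectType R[i]) (act : {bilinear L -> V -> V}) (rho : E -> L).
Local Notation wt := (weight_space ip act rho).

(** The sum of the weight spaces with weight in [Q], built one vector at a time so that stability
    under the action is checked on single weight vectors. *)
Inductive wsum (Q : E -> Prop) : V -> Prop :=
  | wsum0 : wsum Q 0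
  | wsumS nu u v : Q nu -> wt nu u -> wsum Q v -> wsum Q (u + v).

Lemma wsum1 (Q : E -> Prop) nu u : Q nu -> wt nu u -> wsum Q u.
Proof. by move=> Qn hu; rewrite -(addr0 u); apply: (wsumS Qn hu); exact: wsum0. Qed.

Lemma wsumD Q u v : wsum Q u -> wsum Q v -> wsum Q (u + v).
Proof.
move=> hu hv; elim: hu => [|nu {}u w Qn h _ IH]; first by rewrite add0r.
by rewrite -addrA; exact: (wsumS Qn h IH).
Qed.

Lemma wsumZ Q a u : wsum Q u -> wsum Q (a *: u).
Proof.
elim=> [|nu {}u w Qn h _ IH]; first by rewrite scaler0; exact: wsum0.
by rewrite scalerDr; exact: (wsumS Qn (wtZ a h) IH).
Qed.

Lemma wsum_fun Q s u : uniq s -> (forall nu, weights ip act rho nu -> nu \in s) ->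
  wsum Q u -> exists z : E -> V, [/\ forall nu, wt nu (z nu),
    forall nu, z nu <> 0 -> Q nu & u = \sum_(nu <- s) z nu].
Proof.
move=> us hs; elim=> [|nu {}u w Qn h _ [z [hz zQ ->]]].
  by exists (fun=> 0); split=> [nu|//|]; [exact: wt0|rewrite big1].
have [->|u0] := eqVneq u 0; first by exists z; split; rewrite ?add0r.
have nus : nu \in s by apply: hs; exists u.
exists (fun mu => (if mu == nu then u else 0) + z mu); split=> [mu|mu|].
- by apply: wtD => //; case: eqP => [->//|_]; exact: wt0.
- by have [->//|_] := eqVneq mu nu; rewrite add0r; exact: zQ.
rewrite big_split/=; congr (_ + _); rewrite (bigD1_seq nu)//= eqxx big1 ?addr0//.
by move=> mu /negPf->.
Qed.

(** By independence of weight spaces, the component at [nu] in any decomposition of u is u itself,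
    which is nonzero. *)
Lemma wsum_weight Q nu u : wsum Q u -> wt nu u -> u != 0 -> Q nu.
Proof.
move=> hu hn u0; have [s us hs] := weights_finite ip act rho.
have nus : nu \in s by apply: hs; exists u.
have [z [hz zQ e]] := wsum_fun us hs hu.
have h : \sum_(mu <- s) (z mu - (if mu == nu then u else 0)) = 0.
  rewrite sumrB -e (bigD1_seq nu)//= eqxx big1 ?addr0 ?subrr//.
  by move=> mu /negPf->.
have := wt_indep (z := fun mu => z mu - (if mu == nu then u else 0)) us _ h nus.
rewrite eqxx => h'; apply: zQ => zn.
have /eqP : z nu - u = 0.
  apply: h' => mu _; apply: wtD => //; rewrite -scaleN1r; apply: wtZ.
  by case: eqP => [->//|_]; exact: wt0.
by rewrite zn sub0r oppr_eq0 (negPf u0).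
Qed.

Lemma irreducible_ind (P : V -> Prop) : is_irreducible_rep act ->
  P 0 -> (forall a u v, P u -> P v -> P (a *: u + v)) ->
  (forall x u, P u -> P (act x u)) -> (exists2 v, v != 0 & P v) ->
  forall v, P v.
Proof.
move=> [_ irr] P0 PD Pact [v v0 Pv] u.
have [U hU] := submod_vspace P0 PD.
have [x w /hU/(Pact x)/hU//|U0|Uf] := irr U.
  by move/hU: Pv; rewrite U0 memv0 (negPf v0).
by apply/hU; rewrite Uf memvf.
Qed.

Lemma weight_basis : (forall v, wsum (fun=> True) v) ->
  exists d (X : d.-tuple V) (nu : 'I_d -> E),
    basis_of fullv X /\ forall j, wt (nu j) (tnth X j).
Proof.
move=> hV; pose Q k := `[< exists X : seq V, [/\ size X = k, free X &
  forall u, u \in X -> exists nu, wt nu u] >].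
have Q0 : exists k, Q k.
  by exists 0%N; apply/asboolP; exists [::]; split=> //; exact: nil_free.
have Qb k : Q k -> (k <= \dim {:V})%N.
  by move=> /asboolP[X [<- /eqP <- _]]; rewrite dimvS ?subvf.
case: (ex_maxnP Q0 Qb) => k /asboolP[X [sX fX hX]] kmax.
have spanX u nu : wt nu u -> u \in <<X>>%VS.
  move=> hu; apply: contraT => uX; have /kmax : Q k.+1.
    apply/asboolP; exists (u :: X); rewrite /= sX free_cons uX fX; split=> // w.
    by rewrite inE => /orP[/eqP->|/hX//]; exists nu.
  by rewrite ltnn.
have fullX : <<X>>%VS = fullv.
  apply/eqP; rewrite eqEsubv subvf; apply/subvP => v _.
  by elim: (hV v) => [|nu u w _ hu _ IH]; rewrite ?mem0v ?memvD ?(spanX u nu).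
have [nu hnu] := choice (fun j => hX _ (mem_tnth j (in_tuple X))).
exists (size X), (in_tuple X), nu; split=> //.
by rewrite /basis_of /= fullX eqxx.
Qed.
End WeightSums.

Lemma complex_lin_eq0 (R : realType) (a b : R) :
  a%:C + 'i * b%:C = 0 -> a = 0 /\ b = 0.
Proof.
move=> h; have : (a ^+ 2 + b ^+ 2)%:C = 0.
  have -> : (a ^+ 2 + b ^+ 2)%:C =
      (a%:C + 'i * b%:C) * (a%:C - 'i * b%:C) :> R[i].
    rewrite mulrC -subr_sqr exprMn sqrCi rmorphD !rmorphXn/=; ring.
  by rewrite h mul0r.
move=> /(@complexI R)/eqP; rewrite paddr_eq0 ?sqr_ge0// !sqrf_eq0.
by move=> /andP[/eqP-> /eqP->].
Qed.

(** * Triples in L and the trace form of a representation *)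

Section LieAlgebra.
Variables (R : realType) (E : vectType R) (ip : {dot E for idfun}).
Variables (L : vectType R[i]) (br : {bilinear L -> L -> L}) (rho : E -> L).
Variable Psi : seq E.
Hypotheses (L_lie : is_lie_bracket br) (L_roots : has_root_system ip br rho Psi).
Local Notation wtL := (weight_space ip br rho).

Lemma brC x y : br x y = - br y x.
Proof.
apply/eqP; rewrite -addr_eq0; have := lie_alt L_lie (x + y).
by rewrite actDl !actDr !(lie_alt L_lie) addr0 add0r => ->.
Qed.

Lemma adjoint_rep : is_representation br br.
Proof.
move=> x y z; have := lie_jacobi L_lie x y z.
rewrite (brC z x) (brC z) actNr => /eqP; rewrite subr_eq0 => /eqP <-.
by [].
Qed.

(** The value on the Cartan element rho y + i rho y' of the form encoded by [nu]. *)
Definition ev (y y' nu : E) : R[i] := (ip nu y)%:C + 'i * (ip nu y')%:C.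

Lemma evD y y' nu mu : ev y y' (nu + mu) = ev y y' nu + ev y y' mu.
Proof. by rewrite /ev !ipDl !rmorphD mulrDr addrACA. Qed.
Lemma evN y y' nu : ev y y' (- nu) = - ev y y' nu.
Proof. by rewrite /ev !ipNl !rmorphN mulrN opprD. Qed.

Section Representation.
Variables (V : vectType R[i]) (act : {bilinear L -> V -> V}).
Hypothesis V_rep : is_representation br act.
Local Notation wt := (weight_space ip act rho).

Lemma act_cartan y y' nu u : wt nu u ->
  act (rho y + 'i *: rho y') u = ev y y' nu *: u.
Proof. by move=> hu; rewrite actDl actZl !hu scalerA -scalerDl. Qed.

Lemma act_root b x nu u : wtL b x -> wt nu u -> wt (nu + b) (act x u).
Proof.
move=> hx hu z; have := V_rep (rho z) x u.
rewrite hx hu actZl actZr => /eqP; rewrite eq_sym subr_eq => /eqP->.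
by rewrite -scalerDl -rmorphD -ipDl addrC.
Qed.

Lemma act_ind (P : V -> Prop) x u : P 0 -> (forall v w, P v -> P w -> P (v + w)) ->
  (forall y, wtL 0 y -> P (act y u)) ->
  (forall b y, b \in Psi -> wtL b y -> P (act y u)) -> P (act x u).
Proof.
move=> P0 PD h0 hb; have [y0 [z [hy hz ->]]] := cartan_decomp L_roots x.
rewrite actDl; apply: (PD); first exact: h0.
rewrite act_suml big_seq; apply: (big_ind P) => //.
move=> b; rewrite mem_undup => bP.
exact: hb (hz b).
Qed.

(** With h = rho y + i rho y', the last condition is [h, e] = 2 e. *)
Definition is_triple b e f y y' := [/\ wtL b e, wtL (- b) f,
  br e f = rho y + 'i *: rho y' & ev y y' b = 2].

Lemma triple_string b e f y y' nu : b != 0 -> is_triple b e f y y' ->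
  weights ip act rho nu ->
  exists m : int, ev y y' nu = m%:~R /\ weights ip act rho (nu - m%:~R *: b).
Proof.
move=> b0 [he hf hef hb] wn.
have comm nu' u : wt nu' u ->
    act e (act f u) = act f (act e u) + ev y y' nu' *: u.
  move=> hu; have := V_rep e f u; rewrite hef (act_cartan _ _ hu) => ->.
  by rewrite addrC subrK.
have [m [hm wm]] : exists m : int, ev y y' nu = m%:~R /\
    (0 <= m -> weights ip act rho (nu - m%:~R *: b)).
  apply: (sl2_string b0 (fun nu u => act_root he) (fun nu u => act_root hf)) wn => //.
  by move=> mu; rewrite evD hb.
have [m0|m0] := leP 0 m; first by exists m; split=> //; exact: wm.
(* For negative m the roles of e and f are exchanged, which negates h. *)
have [m' [hm' wm']] : exists m : int, - ev y y' nu = m%:~R /\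
    (0 <= m -> weights ip act rho (nu - m%:~R *: - b)).
  apply: (sl2_string (hv := fun nu => - ev y y' nu) _ (fun nu u => act_root hf)
    (f := e)) wn => //.
  - by rewrite oppr_eq0.
  - by move=> mu u; rewrite opprK; exact: act_root.
  - by move=> mu u hu; rewrite (comm mu)// scaleNr addrK.
  - by move=> mu; rewrite evD evN hb opprD opprK.
have mm : m' = - m.
  by apply/eqP; rewrite -(eqr_int R[i]) mulrNz -hm hm'.
exists m; split=> //; move: wm'; rewrite mm mulrNz scalerN scaleNr opprK.
by apply; lia.
Qed.

End Representation.

Section TraceForm.
Variables (V : vectType R[i]) (act : {bilinear L -> V -> V}).
Hypothesis V_rep : is_representation br act.
Local Notation wt := (weight_space ip act rho).
Variables (d : nat) (X : d.-tuple V) (nu_ : 'I_d -> E).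
Hypothesis X_basis : basis_of fullv X.
Hypothesis X_weight : forall j, wt (nu_ j) (tnth X j).

(** Row j holds the image of the j-th basis vector, so composition becomes multiplication in the
    opposite order. *)
Definition amx x : 'M[R[i]]_d := \matrix_(j, k) coord X k (act x (tnth X j)).

Lemma coord_tnth j k : coord X k (tnth X j) = (j == k)%:R.
Proof. by rewrite (tnth_nth 0) coord_free ?(basis_free X_basis). Qed.

Lemma amx_is_linear a x y : amx (a *: x + y) = a *: amx x + amx y.
Proof. by apply/matrixP => j k; rewrite !mxE actDl actZl linearP. Qed.

Lemma amx_mul x y j l :
  (amx x *m amx y) j l = coord X l (act y (act x (tnth X j))).
Proof.
rewrite mxE [in RHS](coord_basis X_basis (memvf (act x (tnth X j)))).
rewrite act_sumr linear_sum/=; apply: eq_bigr => k _.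
by rewrite !mxE actZr linearZ/= (tnth_nth 0 X k).
Qed.

Lemma amx_br x y : amx (br x y) = amx y *m amx x - amx x *m amx y.
Proof.
apply/matrixP => j k; rewrite [RHS]mxE [X in _ + X]mxE !amx_mul mxE.
by rewrite V_rep linearB.
Qed.

Lemma amx_rho x j k : amx (rho x) j k = (ip (nu_ j) x)%:C * (j == k)%:R.
Proof. by rewrite mxE X_weight linearZ/= coord_tnth. Qed.

Definition trf x y := \tr (amx x *m amx y).

Lemma trfC x y : trf x y = trf y x.
Proof. exact: mxtrace_mulC. Qed.

Lemma trf_linear a x y z : trf (a *: x + y) z = a * trf x z + trf y z.
Proof. by rewrite /trf amx_is_linear mulmxDl -scalemxAl linearP. Qed.

Lemma trfZ a x z : trf (a *: x) z = a * trf x z.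
Proof.
rewrite -[a *: x]addr0 trf_linear /trf (_ : amx 0 = 0) ?mul0mx ?mxtrace0 ?addr0//.
by apply/matrixP => j k; rewrite !mxE act0l linear0.
Qed.

Lemma trfD x y z : trf (x + y) z = trf x z + trf y z.
Proof. by rewrite -{1}(scale1r x) trf_linear mul1r. Qed.

Lemma trf_br x y z : trf (br x y) z = trf x (br y z).
Proof.
by rewrite /trf !amx_br mxtrace_commutator.
Qed.

Lemma trf_rho x y :
  trf (rho x) (rho y) = (\sum_j ip (nu_ j) x * ip (nu_ j) y)%:C.
Proof.
rewrite /trf /mxtrace rmorph_sum/=; apply: eq_bigr => j _.
rewrite mxE (bigD1 j)//= !amx_rho eqxx !mulr1 big1 ?addr0 ?rmorphM// => k kj.
by rewrite amx_rho eq_sym (negPf kj) mulr0 mul0r.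
Qed.

(** Moving [rho x] across the form by invariance gives (b + c, x) [trf e f] = 0 for every x. *)
Lemma trf_weight_orth b c e f : wtL b e -> wtL c f -> trf e f != 0 -> b + c = 0.
Proof.
move=> he hf t0; apply: (@ip_nondeg _ _ ip) => x.
have := trf_br e (rho x) f; rewrite brC hf he -scaleNr trfZ trfC.
rewrite [RHS]trfC trfZ (trfC f) => /eqP; rewrite eq_sym -subr_eq0 -mulrBl mulf_eq0.
rewrite (negPf t0) orbF opprK -rmorphD -ipDl addrC.
by rewrite -(rmorph0 (real_complex R)) (inj_eq (@complexI R)) => /eqP.
Qed.

(** The radical is an ideal, so if nonzero it contains [rho lam]. Then the eigenvalues of [rho lam]
    on the basis have squares with sum 0, although it acts on v by the nonzero number (lam, lam). *)
Lemma trf_nondeg lam v : is_simple_lie br -> v != 0 -> lam != 0 -> wt lam v ->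
  forall x, (forall y, trf x y = 0) -> x = 0.
Proof.
move=> [_ simple] v0 lam0 hv x hx.
have [|a u w hu hw y|I hI] := @submod_vspace _ L (fun x => forall y, trf x y = 0).
- by move=> y; rewrite -(scale0r x) trfZ mul0r.
- by rewrite trf_linear hu hw mulr0 addr0.
have [y w /hI hw|I0|If] := simple I.
- by apply/hI => z; rewrite brC -scaleN1r trfZ trf_br hw mulr0.
- by move/hI: hx; rewrite I0 memv0 => /eqP.
have := (hI (rho lam)).1; rewrite If memvf => /(_ isT (rho lam)).
rewrite trf_rho => /(@complexI R)/eqP; rewrite psumr_eq0; last first.
  by move=> j _; rewrite -expr2 sqr_ge0.
move=> /allP h; have act0 : act (rho lam) v = 0.
  rewrite (coord_basis X_basis (memvf v)) act_sumr big1// => j _.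
  rewrite actZr -(tnth_nth 0) X_weight; have := h j (mem_index_enum _).
  by rewrite -expr2 sqrf_eq0 => /eqP->; rewrite scale0r scaler0.
have /eqP := hv lam; rewrite act0 eq_sym scaler_eq0 (negPf v0) orbF.
by rewrite -(rmorph0 (real_complex R)) (inj_eq (@complexI R)) ip_eq0 (negPf lam0).
Qed.

(* If b vanished on h = [e, f], then the trace form, which is positive on rho E
   and satisfies trf h (rho x) = (b, x) trf e f, would annihilate h. *)
Lemma ex_triple b : (forall x, (forall y, trf x y = 0) -> x = 0) ->
  b \in Psi -> b != 0 -> exists e f y y', is_triple b e f y y'.
Proof.
move=> nondeg bP b0; have [e e0 he] := cartan_root L_roots bP.
(* Otherwise e would be orthogonal to every weight space, hence to all of L. *)
have [f [hf t0]] : exists f, wtL (- b) f /\ trf e f != 0.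
  apply: contrapT => h; move/eqP: e0; apply; apply: nondeg => y.
  have orth c z : wtL c z -> trf e z = 0.
    move=> hz; apply/eqP; apply: contraT => t0; case: h; exists z; split=> //.
    by have /eqP := trf_weight_orth he hz t0; rewrite addrC addr_eq0 => /eqP <-.
  have [y0 [z [hy hz ->]]] := cartan_decomp L_roots y.
  rewrite trfC trfD (trfC y0) (orth _ _ hy) add0r.
  apply: (big_ind (fun w => trf w e = 0)) => [|u w hu hw|c _].
  - by rewrite -(scale0r e) trfZ mul0r.
  - by rewrite trfD hu hw addr0.
  - by rewrite trfC; exact: orth (hz c).
have he0 : wtL 0 (br e f).
  by rewrite -(addNr b); apply: (act_root adjoint_rep).
have [y [y' hyy]] := (cartan_zero L_roots _).1 he0.
have key x : trf (br e f) (rho x) = (ip b x)%:C * trf e f.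
  rewrite trf_br brC hf -scaleN1r scalerA trfC trfZ (trfC f).
  by rewrite ipNl rmorphN mulN1r opprK.
pose T x x' := \sum_j ip (nu_ j) x * ip (nu_ j) x'.
have keyT x : (T y x)%:C + 'i * (T y' x)%:C = (ip b x)%:C * trf e f.
  by rewrite -key hyy trfD trfZ !trf_rho.
have T0 x : T x x = 0 -> forall x', T x x' = 0.
  move=> /eqP; rewrite psumr_eq0 => [/allP h x'|j _]; last by rewrite -expr2 sqr_ge0.
  rewrite /T big1// => j _; have := h j (mem_index_enum _).
  by rewrite -expr2 sqrf_eq0 => /eqP->; rewrite mul0r.
have evb : ev y y' b != 0.
  apply/eqP => /complex_lin_eq0[by0 by'0].
  have [Ty _] : T y y = 0 /\ T y' y = 0.
    by apply: complex_lin_eq0; rewrite keyT by0 mul0r.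
  have [_ Ty'] : T y y' = 0 /\ T y' y' = 0.
    by apply: complex_lin_eq0; rewrite keyT by'0 mul0r.
  have := keyT b; rewrite (T0 _ Ty) (T0 _ Ty') mulr0 addr0 => /esym/eqP.
  rewrite mulf_eq0 (negPf t0) orbF -(rmorph0 (real_complex R)).
  by rewrite (inj_eq (@complexI R)) ip_eq0 (negPf b0).
pose c := 2 / ev y y' b.
have [z [z' hzz]] := (cartan_zero L_roots _).1 (wtZ c he0).
exists (c *: e), f, z, z'; split=> //; first exact: wtZ.
  by rewrite actZl.
have := act_cartan z z' he; rewrite -hzz hyy actZl (act_cartan _ _ he).
rewrite scalerA /c mulfVK// => /eqP; rewrite -subr_eq0 -scalerBl scaler_eq0.
by rewrite (negPf e0) orbF subr_eq0 => /eqP.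
Qed.

End TraceForm.

End LieAlgebra.

(** * Representations of the dual Lie algebra *)

Section DualLieAlgebra.
Variables (R : realType) (E : vectType R) (ip : {dot E for idfun}).
Variables (Phi : seq E) (n : nat) (alpha : n.-tuple E).
Variables (L : vectType R[i]) (br : {bilinear L -> L -> L}) (rho : E -> L).
Hypothesis Phi_rs : is_root_system ip Phi.
Hypothesis alpha_simple : is_simple_system Phi alpha.
Hypotheses (L_lie : is_lie_bracket br) (L_simple : is_simple_lie br).
Hypothesis L_roots : has_root_system ip br rho (dual_roots ip Phi).

Local Notation al j := (tnth alpha j).
Local Notation rf := (reflection ip).
Local Notation Psi := (dual_roots ip Phi).
Local Notation dal := (dual_simple ip alpha).
Local Notation wtL := (weight_space ip br rho).

Lemma dual_rootP c : c \in Psi <-> exists2 g, g \in Phi & c = coroot ip g.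
Proof. by split=> [/mapP//|[g gP ->]]; exact: map_f. Qed.

Lemma dual_root_neq0 c : c \in Psi -> c != 0.
Proof. by move=> /dual_rootP[g gP ->]; rewrite coroot_neq0// (root_neq0 Phi_rs). Qed.

Lemma dual_rootN c : c \in Psi -> - c \in Psi.
Proof.
move=> /dual_rootP[g gP ->]; apply/dual_rootP; exists (- g); last by rewrite corootN.
exact: (opp_root Phi_rs).
Qed.

Lemma dual_root_rf g c : g \in Phi -> c \in Psi -> rf g c \in Psi.
Proof.
move=> gP /dual_rootP[h hP ->]; apply/dual_rootP; exists (rf g h).
  exact: (root_rf Phi_rs).
by rewrite (coroot_isom (reflection_ip ip g)).
Qed.

Lemma adjoint_weights c : weights ip br rho c -> c \in 0 :: Psi.
Proof.
move=> [v v0 hv]; have [y0 [z [h0 hz e]]] := cartan_decomp L_roots v.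
apply: (wsum_weight (Q := fun nu => nu \in 0 :: Psi) _ hv v0); rewrite e.
apply: wsumD; first by apply: wsum1 h0; rewrite mem_head.
rewrite big_seq; apply: big_ind => [|u w|b]; [exact: wsum0|exact: wsumD|].
by rewrite mem_undup => bP; apply: wsum1 (hz b); rewrite inE bP orbT.
Qed.

Lemma ip_simple_inj u w : (forall g, g \in Phi -> ip g u = ip g w) -> u = w.
Proof.
move=> h; apply/eqP; rewrite -subr_eq0; apply/eqP/(@ip_nondeg _ _ ip) => v.
rewrite (coE alpha_simple v) ip_sumr big1// => j _; rewrite ipZr ipC ipDr ipNr.
by rewrite h ?subrr ?mulr0// (simple_root alpha_simple).
Qed.

(* The reflection attached to the triple and the orthogonal one both preserve
   the roots; their product is unipotent, hence trivial as there are finitely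
   many roots. *)
Lemma triple_coroot g e f y y' : g \in Phi ->
  is_triple ip br rho (coroot ip g) e f y y' -> y = g /\ y' = 0.
Proof.
move=> gP tr; have g0 := root_neq0 Phi_rs gP; set b := coroot ip g.
have b0 : b != 0 by exact: coroot_neq0.
have split_ev c (m : R) : ev ip y y' c = m%:C -> ip c y = m /\ ip c y' = 0.
  rewrite /ev => /eqP; rewrite -subr_eq0 addrAC -rmorphB => /eqP/complex_lin_eq0.
  by move=> [/eqP]; rewrite subr_eq0 => /eqP.
have [by2 _] : ip b y = 2 /\ ip b y' = 0.
  by apply: split_ev; case: tr => _ _ _ ->; rewrite rmorph_nat.
have bg : ip b g = 2 by rewrite ipC ip_self_coroot.
(* The product of the two reflections sends c to c + l c b, and l b = 0. The value 0 stays in the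
   list since a reflected adjoint weight is only known to be a root or 0. *)
pose l c := ip c y - ip c g.
have step c : c \in 0 :: Psi -> c + l c *: b \in 0 :: Psi /\ ip c y' = 0.
  rewrite inE => /orP[/eqP->|cP].
    by rewrite /l !ip0l subrr scale0r addr0 mem_head.
  have [u u0 hu] := cartan_root L_roots cP.
  have [m [hm]] := triple_string (adjoint_rep L_lie) b0 tr
    (ex_intro2 _ _ u u0 hu).
  have [cy cy'] : ip c y = m%:~R /\ ip c y' = 0.
    by apply: split_ev; rewrite hm rmorph_int.
  move=> /adjoint_weights cm; split=> //.
  have -> : c + l c *: b = rf g (c - m%:~R *: b).
    have rb : rf g b = - b.
      by rewrite -(coroot_isom (reflection_ip ip g))/= reflection_self// corootN.
    rewrite [RHS]linearB/= [rf g (_ *: b)]linearZ/= rb scalerN opprK reflectionE -/b /l cy.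
    by rewrite -addrA -scaleNr -scalerDl addrC [- _ + _]addrC addrC.
  move: cm; rewrite inE => /orP[/eqP->|cm]; first by rewrite linear0 mem_head.
  by rewrite inE dual_root_rf ?orbT.
have l0 c : c \in 0 :: Psi -> l c = 0.
  move=> cP; apply: contrapT => lc.
  have lb t : l (c + t *: b) = l c.
    by rewrite /l !ipDl !(ipZl _ t b) by2 bg opprD addrACA subrr addr0.
  have [|k] := @finite_escape _ (0 :: Psi) (fun k => c + (l c *+ k) *: b).
    move=> j k /addrI/eqP; rewrite -subr_eq0 -scalerBl scaler_eq0 (negPf b0) orbF.
    rewrite subr_eq0 -(mulr_natr _ j) -(mulr_natr _ k).
    move=> /eqP/(mulfI _) => /(_ (introN eqP lc))/eqP.
    by rewrite eqr_nat => /eqP.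
  move=> /negP; apply; elim: k => [|k IH]; first by rewrite scale0r addr0.
  by have [] := step _ IH; rewrite lb -addrA -scalerDl -mulrSr.
have cor h u w : ip (coroot ip h) u = ip (coroot ip h) w -> h \in Phi -> ip h u = ip h w.
  move=> + hP; rewrite !ipZl => /mulfI; apply.
  by rewrite mulf_neq0 ?invr_eq0 ?pnatr_eq0// lt0r_neq0// ip_gt0// (root_neq0 Phi_rs).
split; apply: ip_simple_inj => h hP; apply: cor => //.
all: have hD : coroot ip h \in 0 :: Psi by rewrite inE map_f ?orbT.
  by apply/eqP; rewrite -subr_eq0; apply/eqP; exact: l0.
by rewrite ip0r; case: (step _ hD).
Qed.

Section Representation.
Variables (V : vectType R[i]) (act : {bilinear L -> V -> V}) (phi : E).
Hypotheses (V_rep : is_representation br act) (V_irr : is_irreducible_rep act).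
Hypothesis V_hw : is_highest_weight ip br act rho Psi dal phi.
Hypothesis phi_neq0 : phi != 0.

Local Notation wt := (weight_space ip act rho).

(** The sum of all weight spaces is stable under L, because root vectors shift weights, and it
    contains the highest weight vector. *)
Lemma rep_wsum v : wsum ip act rho (fun=> True) v.
Proof.
apply: (irreducible_ind V_irr) v => [|a u v hu hv|x u hu|]; first exact: wsum0.
- by apply: wsumD => //; exact: wsumZ.
- elim: hu => [|nu {}u w _ hu _ IH]; first by rewrite act0r; exact: wsum0.
  rewrite actDr; apply: wsumD => //; apply: (act_ind L_roots).
  + exact: wsum0.
  + by move=> ? ?; exact: wsumD.
  + by move=> y hy; apply: wsum1 (act_root V_rep hy hu).
  + by move=> b y _ hy; apply: wsum1 (act_root V_rep hy hu).
- by have [v [v0 hv _]] := V_hw; exists v => //; exact: wsum1 hv.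
Qed.

Lemma ex_coroot_triple g : g \in Phi ->
  exists e f, is_triple ip br rho (coroot ip g) e f g 0.
Proof.
move=> gP; have [d [X [nu [Xb Xw]]]] := weight_basis rep_wsum.
have [v [v0 hv _]] := V_hw.
have nondeg := trf_nondeg L_lie V_rep Xb Xw L_simple v0 phi_neq0 hv.
have bP : coroot ip g \in Psi by apply: map_f.
have [e [f [y [y' tr]]]] :=
  ex_triple L_lie L_roots V_rep Xb Xw nondeg bP (dual_root_neq0 bP).
by have [yg y0] := triple_coroot gP tr; rewrite yg y0 in tr; exists e, f.
Qed.

Lemma weights_rf nu g : weights ip act rho nu -> g \in Phi ->
  (exists m : int, ip nu g = m%:~R) /\ weights ip act rho (rf g nu).
Proof.
move=> wn gP; have [e [f tr]] := ex_coroot_triple gP.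
have b0 := coroot_neq0 ip (root_neq0 Phi_rs gP).
have [m [hm wm]] := triple_string V_rep b0 tr wn.
have mE : ip nu g = m%:~R.
  apply: (@complexI R); rewrite rmorph_int -hm /ev ip0r.
  by rewrite rmorph0 mulr0 addr0.
by split; [exists m|rewrite reflectionE mE].
Qed.

(** * Weights lie below the highest weight *)

Section HighestWeightVector.
Variable v : V.
Hypothesis v_wt : wt phi v.
Hypothesis v_killed : forall b, pos_roots Psi dal b ->
  forall y, wtL b y -> act y v = 0.

(* Indexing by word length lets positive root vectors act without raising the
   index, so that no PBW basis is needed. *)
Inductive low : nat -> V -> Prop :=
  | low_hw : low 0 v
  | low_zero k : low k 0
  | low_lin k a u w : low k u -> low k w -> low k (a *: u + w)
  | low_up k u : low k u -> low k.+1 u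
  | low_act k b y u : pos_roots Psi dal b -> wtL (- b) y -> low k u ->
      low k.+1 (act y u).

Lemma low_add k u w : low k u -> low k w -> low k (u + w).
Proof. by move=> hu hw; rewrite -[u]scale1r; exact: low_lin. Qed.

Lemma low_scale k a u : low k u -> low k (a *: u).
Proof. by move=> hu; rewrite -[_ *: _]addr0; apply: low_lin => //; exact: low_zero. Qed.

Lemma low_le j k u : (j <= k)%N -> low j u -> low k u.
Proof.
move=> /subnK <-; elim: (k - j)%N => [//|m IH] /IH; rewrite addSn; exact: low_up.
Qed.

Lemma dual_root_sign c : c \in Psi -> pos_roots Psi dal c \/ pos_roots Psi dal (- c).
Proof.
move=> cP; have ncP := dual_rootN cP; have /dual_rootP[g gP cE] := cP.
have [gp|gp] := root_sign alpha_simple gP; [left|right]; split=> //; rewrite cE.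
  exact: (pos_coroot Phi_rs alpha_simple).
by rewrite -corootN; apply: (pos_coroot Phi_rs alpha_simple) => //; exact: (opp_root Phi_rs).
Qed.

Lemma low_step k u z :
  (forall b y, pos_roots Psi dal b -> wtL b y -> low k (act y u)) ->
  (forall y, wtL 0 y -> low k (act y u)) -> low k u -> low k.+1 (act z u).
Proof.
move=> hp h0 hu; apply: (act_ind L_roots) => [|? ?|y hy|b y bP hy].
- exact: low_zero.
- exact: low_add.
- exact/low_up/h0.
have [bp|bp] := dual_root_sign bP; first exact: low_up (hp _ _ bp hy).
by apply: (low_act bp) => //; rewrite opprK.
Qed.

(** On [act y u] one has x y u = [x, y] u + y x u. The bracket may be any element of L, but acting
    on u it raises the index by at most one, and that is the index of [act y u]. *)
Lemma low_borel k u : low k u ->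
  (forall b y, pos_roots Psi dal b -> wtL b y -> low k (act y u)) /\
  (forall y, wtL 0 y -> low k (act y u)).
Proof.
elim=> {k u} [|k|k a u w _ [hp h0] _ [hp' h0']|k u _ [hp h0]|k b y u bp hy hu [hp h0]].
- split=> [b y bp hy|y hy]; first by rewrite (v_killed bp hy); exact: low_zero.
  have [x [x' ->]] := (cartan_zero L_roots y).1 hy.
  by rewrite (act_cartan _ _ v_wt); apply: low_scale; exact: low_hw.
- by split=> *; rewrite act0r; exact: low_zero.
- by split=> *; rewrite actDr actZr; apply: low_lin; eauto.
- by split=> *; apply: low_up; eauto.
have swap x : low k (act x u) -> low k.+1 (act x (act y u)).
  move=> hx; have -> : act x (act y u) = act (br x y) u + act y (act x u).
    by rewrite V_rep subrK.
  by apply: low_add; [exact: low_step|exact: low_act bp hy hx].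
by split=> [c x cp hx|x hx]; apply: swap; eauto.
Qed.

Lemma low_wsum k u : low k u ->
  wsum ip act rho (fun nu => nncomb dal predT (phi - nu)) u.
Proof.
elim=> {k u} [|k|k a u w _ hu _ hw|//|k b y u [_ bp] hy _ hu].
- by apply: wsum1 v_wt; rewrite subrr; exact: nncomb0.
- exact: wsum0.
- by apply: wsumD => //; exact: wsumZ.
elim: hu => [|nu {}u w hn hu _ IH]; first by rewrite act0r; exact: wsum0.
rewrite actDr; apply: wsumD => //; apply: wsum1 (act_root V_rep hy hu).
by rewrite opprD opprK addrA; exact: nncombD.
Qed.
End HighestWeightVector.

Lemma weights_le nu : weights ip act rho nu -> nncomb dal predT (phi - nu).
Proof.
move=> [u u0 hu]; have [v [v0 hv vk]] := V_hw.
have [|a x w [j hj] [k hk]|x w [k hk]||k hk] :=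
    irreducible_ind (P := fun u => exists k, low v k u) V_irr _ _ _ _ u.
- by exists 0%N; exact: low_zero.
- exists (maxn j k); apply: low_lin; [apply: low_le hj|apply: low_le hk].
    exact: leq_maxl.
  exact: leq_maxr.
- have [hp h0] := low_borel hv vk hk.
  by exists k.+1; exact: low_step.
- by exists v => //; exists 0%N; exact: low_hw.
exact: wsum_weight (low_wsum hv hk) hu u0.
Qed.

End Representation.
End DualLieAlgebra.

Local Close Scope complex_scope.

(** * Weights of V as the orbit of phi, and the isomorphism *)

Theorem theorem3p7 (R : realType) (E : vectType R) (ip : {dot E for idfun})
    (Phi : seq E) (n : nat) (alpha : n.-tuple E) (theta : E) (i : 'I_n)
    (phi : E)
    (L : vectType R[i]) (br : {bilinear L -> L -> L}) (rho : E -> L)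
    (V : vectType R[i]) (act : {bilinear L -> V -> V})
    (Phi_rs : is_root_system ip Phi) (Phi_irr : is_irreducible_rs ip Phi)
    (alpha_simple : is_simple_system Phi alpha)
    (theta_highest : is_highest_root Phi alpha theta)
    (abelian_case : coord alpha i theta = 1)
    (phi_fund : forall j, ip phi (tnth alpha j) = (i == j)%:R)
    (L_lie : is_lie_bracket br) (L_simple : is_simple_lie br)
    (L_roots : has_root_system ip br rho (dual_roots ip Phi))
    (V_rep : is_representation br act) (V_irr : is_irreducible_rep act)
    (V_hw : is_highest_weight ip br act rho
              (dual_roots ip Phi) (dual_simple ip alpha) phi) :
  exists f : set E -> E,
    [/\ forall w, W0 ip Phi alpha i w ->
          antichains Phi alpha i (Gamma Phi alpha i w) /\
          f (Gamma Phi alpha i w) = w phi,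
        forall G, antichains Phi alpha i G ->
          exists2 w, W0 ip Phi alpha i w & G = Gamma Phi alpha i w,
        set_bij (antichains Phi alpha i) (weights ip act rho) f &
        forall G G', antichains Phi alpha i G -> antichains Phi alpha i G' ->
          (le_up Phi alpha i G G' <->
           root_le (dual_simple ip alpha) (f G) (f G'))].
Proof.
have phi_ai : ip phi (tnth alpha i) = 1 by rewrite phi_fund eqxx.
(* A nonzero weight is what makes the trace form of V nondegenerate. *)
have phi0 : phi != 0.
  by apply: contra_eq_neq phi_ai => ->; rewrite ip0l eq_sym oner_eq0.
have w_rf nu g : weights ip act rho nu -> g \in Phi ->
    (exists m : int, ip nu g = m%:~R) /\ weights ip act rho (reflection ip g nu).
  exact: (weights_rf Phi_rs alpha_simple L_lie L_simple L_roots V_rep V_irr V_hw).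
have w_orbit nu : weights ip act rho nu -> exists t, nu = sref ip alpha t phi.
  apply: (saturated_orbit Phi_rs alpha_simple theta_highest abelian_case phi_fund).
    by move=> {}nu j wn; apply: w_rf wn (simple_root alpha_simple j).
  by move=> {}nu; apply: (weights_le Phi_rs alpha_simple L_roots V_rep V_irr V_hw).
have orbit_w t : weights ip act rho (sref ip alpha t phi).
  elim: t => [|j t IH] /=; first by have [v [v0 hv _]] := V_hw; exists v.
  exact: (w_rf _ _ IH (simple_root alpha_simple j)).2.
have -> : weights ip act rho = [set sref ip alpha s phi | s in setT].
  apply/seteqP; split=> nu; last by move=> [t _ <-].
  by move=> /w_orbit[t ->]; exists t.
exact: (antichains_orbit Phi_rs alpha_simple theta_highest abelian_case phi_fund).
Qed.
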